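(* Let $F$ be a contractive function, with $G(x)=xF(x)$, and assume that $\mu$ satisfies the strong $F$-Sobolev inequality with constant $C_{SF}>0$. Let $V$ be such that $\int V d\mu = 0$ and $\int V^2 d\mu = m^2 <+\infty$. Then for every probability measure $\nu$ absolutely continuous with respect to $\mu$, all $t>0$ and all $R>0$, $$\mathbb{P}_\nu\left(\frac{1}{t} \int_0^{t} V(X_s) ds \geq R\right)\leq \left\| \frac{d\nu}{d\mu}\right\|_{\mathbb{L}^2(\mu)} \exp \left\{ - t \sup_{0\leq \lambda \leq \lambda_2} \left(R \lambda - \frac{2 m^2 C_{SF}}{G(1)}\, \lambda^2\right)\right\},$$ where $\lambda_2=\dfrac{G(1)}{2\, C_{SF}\, N_{G^*}(V)}$ (with $\lambda_2=0$ if $N_{G^*}(V)=+\infty$).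
   Context: $E$ is a Polish space and $(X_t,(\mathbb{P}_x)_{x\in E})$ is a conservative continuous-time Markov process on $E$ with semigroup $(P_t)_{t\ge 0}$ and infinitesimal generator $L$ with domain $D(L)$ (in $\mathbb{L}^2(\mu)$). $\mu$ is a probability measure on $E$ that is invariant and ergodic for $(P_t)$. $\mathbb{P}_\nu$ denotes the law of the process with initial distribution $\nu$. $\langle\cdot,\cdot\rangle_\mu$ is the inner product of $\mathbb{L}^2(\mu)$. A function $F$ is called contractive if $F(x)\to+\infty$ as $x\to+\infty$ and $x\mapsto G(x):=xF(x)$ is a normalised Young function: $G$ (defined on $\mathbb{R}^+$) is convex, non-decreasing, satisfies $G(0)=0$ and $G(1)+G^*(1)=1$, where $G^*$ is the Fenchel-Legendre conjugate of $G$. The gauge norm of $G$ is $N_G(f)=\inf\{u>0\;;\;\int G(|f|/u)\,d\mu\le G(1)\}$, and likewise $N_{G^*}(f)=\inf\{u>0\;;\;\int G^*(|f|/u)\,d\mu\le G^*(1)\}$. $\mu$ satisfies the strong $F$-Sobolev inequality with constant $C_{SF}$ if for all $g\in D(L)$ with $\int g\, d\mu=0$ and $\int g^2 d\mu=1$, $$\int g^2F(g^2)\,d\mu\le -C_{SF}\,\langle Lg,g\rangle_\mu .$$ The right-hand side of the claim is $+\infty$ if $d\nu/d\mu\notin\mathbb{L}^2(\mu)$. *)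

(* Defs.v *)
From HB Require Import structures.
From mathcomp Require Import all_boot all_order all_algebra.
From mathcomp Require Import all_classical all_reals all_analysis.

Set Implicit Arguments.
Unset Strict Implicit.
Unset Printing Implicit Defensive.

Import Order.TTheory GRing.Theory Num.Theory.
Import numFieldNormedType.Exports.

Local Open Scope classical_set_scope.
Local Open Scope ring_scope.

Definition metrizes (R : realType) (E : topologicalType) (dist : E -> E -> R) :=
  [/\ forall x y, dist x y = 0 <-> x = y,
      forall x y, dist x y = dist y x,
      forall x y z, dist x z <= dist x y + dist y z
    & forall x (A : set E),
        nbhs x A <-> exists2 e : R, 0 < e & [set y | dist x y < e] `<=` A].

Definition complete_distance (R : realType) (E : topologicalType)
    (dist : E -> E -> R) :=
  forall u : nat -> E,
    (forall e : R, 0 < e ->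
      exists N, forall m n, (N <= m)%N -> (N <= n)%N -> dist (u m) (u n) < e) ->
    exists l : E, u @ \oo --> l.

Definition polish_space (R : realType) (E : topologicalType) :=
  (exists2 S : set E, countable S & dense S) /\
  (exists2 dist : E -> E -> R, metrizes dist & complete_distance dist).

Notation borelType E := (g_sigma_algebraType (@open E)).

Section markov.
Local Open Scope ereal_scope.
Context (R : realType) (dE dO : measure_display).
Context (E : measurableType dE) (Omega : measurableType dO).
Variables (X : R -> Omega -> E) (P : R.-pker E ~> Omega).

(* The time set is [0, +oo[: X is never used at negative times. *)

Definition natural_filtration (s : R) : set (set Omega) :=
  <<s \bigcup_(u in `[0%R, s]) preimage_set_system setT (X u) measurable >>.

(* P x is the law of the process started at x.  Conservativeness is built in:
   P x is a probability and X t takes its values in E for every t >= 0.  Joint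
   measurability in time and omega gives a meaning to the integral of V (X s)
   with respect to s. *)
Definition markov_process :=
  [/\ measurable_fun [set p : measurableTypeR R * Omega | (0 <= p.1 :> R)%R]
        (fun p => X p.1 p.2),
      forall x B, measurable B -> P x (X 0%R @^-1` B) = \d_x B
    & forall x s t A B, (0 <= s)%R -> (0 <= t)%R ->
        natural_filtration s A -> measurable B ->
        P x (A `&` X (s + t)%R @^-1` B) =
        \int[P x]_(w in A) P (X s w) (X t @^-1` B)].

Definition law_from (nu : {measure set E -> \bar R}) (A : set Omega) : \bar R :=
  \int[nu]_x P x A.

Definition transition_semigroup (t : R) (f : E -> R) (x : E) : R :=
  (\int[P x]_w f (X t w))%R.

Section stationary.
Variable mu : probability E R.

Definition invariant_measure :=
  forall t B, (0 <= t)%R -> measurable B -> law_from mu (X t @^-1` B) = mu B.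

Definition ergodic_measure :=
  forall B, measurable B ->
    (forall t, (0 <= t)%R ->
      {ae mu, forall x, P x (X t @^-1` B) = (\1_B x)%:E}) ->
    mu B = 0 \/ mu B = 1.

(* The standing requirement for an L2(mu)-generator to make sense.  It is not a
   restriction: an invariant mu and a jointly measurable process imply it. *)
Definition L2_strongly_continuous :=
  forall f, f \in Lfun mu 2%:E ->
    'N[mu]_2%:E[(fun x => (transition_semigroup t f x - f x)%:E)]
      @[t --> 0%R^'+] --> 0.

(* g belongs to the domain of the L2(mu)-generator L and L g = Lg (a.e.) *)
Definition L2_generator (g Lg : E -> R) :=
  [/\ g \in Lfun mu 2%:E, Lg \in Lfun mu 2%:E
    & 'N[mu]_2%:E[(fun x => ((transition_semigroup t g x - g x) / t - Lg x)%:E)]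
        @[t --> 0%R^'+] --> 0].

Definition strong_F_sobolev (F : R -> R) (C : R) :=
  forall g Lg, L2_generator g Lg ->
    \int[mu]_x (g x)%:E = 0 -> \int[mu]_x (g x ^+ 2)%:E = 1 ->
    \int[mu]_x (g x ^+ 2 * F (g x ^+ 2))%:E <=
    (- C * \int[mu]_x (Lg x * g x))%R%:E.

End stationary.

End markov.

Section young.
Local Open Scope ereal_scope.
Context (R : realType).

Definition fenchel_legendre (G : R -> R) (y : R) : \bar R :=
  ereal_sup [set (x * y - G x)%:E | x in `[0%R, +oo[].

Definition normalised_young (G : R -> R) :=
  [/\ @convex_function R R^o `[0%R, +oo[ G,
      {in `[0%R, +oo[ &, {homo G : x y / (x <= y)%R}},
      G 0%R = 0%R
    & (G 1%R)%:E + fenchel_legendre G 1%R = 1].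

Definition young_of (F : R -> R) (x : R) : R := (x * F x)%R.

Definition contractive_function (F : R -> R) :=
  F x @[x --> +oo%R] --> +oo%R /\ normalised_young (young_of F).

(* It is +oo when no u is admissible. *)
Definition gauge_norm d (T : measurableType d) (mu : {measure set T -> \bar R})
    (Phi : R -> \bar R) (f : T -> R) : \bar R :=
  ereal_inf [set u%:E | u in
    [set u | (0 < u)%R /\ \int[mu]_x Phi (`|f x| / u)%R <= Phi 1%R]].

End young.

(* Main.v *)
Require Import Defs.
From HB Require Import structures.
From mathcomp Require Import all_boot all_order all_algebra.
From mathcomp Require Import all_classical all_reals all_analysis.
From mathcomp Require Import measurable_realfun.
From mathcomp Require Import ring lra.
Import Order.TTheory GRing.Theory Num.Theory.
Import numFieldNormedType.Exports.

(** The probability is bounded by the exponential Chebyshev inequality, so the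
    point is to control the expectation of exp(l * Z_t), where Z_t is the
    integral of V(X_s) over [0, t].  Three ideas are combined.

    Feynman-Kac.  For a bounded potential U >= 0 put
    u_t(x) = E_x exp(int_0^t U(X_s) ds).  Sliding the window of integration by h
    amounts to applying P_h (semigroup_fk), hence u_t lies in the domain of L and
    L u_t = d/dt u_t - U u_t in L2(mu) (fk_generator).  If
    <U g, g> + <L g, g> <= K <g, g> on the domain, then
    d/dt |u_t|^2 = 2 <L u_t + U u_t, u_t> <= 2 K |u_t|^2, so |u_t| <= exp(K t)
    in L2(mu) (fk_growth).  The expansions in h and the convergence of Riemann
    sums rest on one fact: the path is continuous in mean, uniformly in time,
    because mu is invariant and P_t is strongly continuous on L2(mu)
    (path_increment).

    The quadratic form.  For g in the domain, write g = a + h with a the mean of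
    g, and let En = - <L g, g>.  The strong F-Sobolev inequality for h divided
    by its norm s yields both the Poincare inequality G(1) s^2 <= C En and, by
    the Hoelder inequality for the pair (G, G^* ), the bound
    int |V| h^2 <= N C En / G(1), with N the gauge norm of V (sobolev_gauge).
    When 2 C N l <= G(1) the latter costs at most half of the energy En; the
    other half absorbs the cross term 2 l a int V h through Poincare and
    2xy <= x^2 + y^2, which leaves 2 m^2 C l^2 / G(1) (energy_form_le).

    Truncation and density.  V is replaced by its truncation W at level B, with
    U = l (W + B); the error is controlled in L1(mu) by m^2 / B.  The passage
    from mu to nu is the Cauchy-Schwarz inequality with the density of nu
    (density_bound).  This gives the bound for one l up to errors that vanish as
    B grows (mean_exceeds_truncated_bound); the theorem follows on letting B go
    to infinity and optimising over l. *)

Set Implicit Arguments.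
Unset Strict Implicit.
Unset Printing Implicit Defensive.
Local Open Scope classical_set_scope.
Local Open Scope ring_scope.

(** * Extension from indicators, and bounded measurable functions *)

Section functional_induction.
Local Open Scope ereal_scope.
Import HBNNSimple.
Context d (T : measurableType d) (R : realType) (Q : (T -> \bar R) -> Prop).

(** The usual extension scheme, stated for a predicate because it is applied with
    two sigma-algebras: once to functions of the state, once to functions that
    are measurable with respect to the past of the process. *)
Lemma ge0_measurable_ind :
  (forall A, measurable A -> Q (fun x => (\1_A x)%:E)) ->
  (forall (c : R) (f : T -> \bar R), (0 <= c)%R -> (forall x, 0 <= f x) ->
     measurable_fun setT f -> Q f -> Q (fun x => c%:E * f x)) ->
  (forall f g : T -> \bar R, (forall x, 0 <= f x) -> (forall x, 0 <= g x) ->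
     measurable_fun setT f -> measurable_fun setT g ->
     Q f -> Q g -> Q (fun x => f x + g x)) ->
  (forall f_ : nat -> T -> \bar R, (forall n x, 0 <= f_ n x) ->
     (forall n, measurable_fun setT (f_ n)) ->
     (forall x, {homo (f_^~ x) : n m / (n <= m)%N >-> n <= m}) ->
     (forall n, Q (f_ n)) -> Q (fun x => limn (f_^~ x))) ->
  forall f, (forall x, 0 <= f x) -> measurable_fun setT f -> Q f.
Proof.
move=> Q1 QZ QD Qlim f f0 mf.
(* 0 is the indicator of the empty set, the base case of finite sums *)
have Q0 : Q (fun=> 0).
  rewrite (_ : (fun=> 0) = fun x => (\1_(@set0 T) x)%:E); first exact: Q1.
  by apply/funext => x; rewrite indic0.
have Qnn (g : {nnsfun T >-> R}) : Q (fun x => (g x)%:E).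
  rewrite (_ : (fun x => _) = fun x =>
    \sum_(y \in range g) (y * \1_(g @^-1` [set y]) x)%:E); last first.
    by apply/funext => x; rewrite fsumEFin// -fimfunE.
  rewrite (_ : (fun x => _) = fun x => \sum_(y <- finmap.enum_fset (fset_set (range g)))
      (y * \1_(g @^-1` [set y]) x)%:E); last first.
    by apply/funext => x; rewrite fsbig_finite.
  have : forall y, y \in finmap.enum_fset (fset_set (range g)) -> (0 <= y)%R.
    by move=> y; rewrite in_fset_set// => /set_mem[x _ <-].
  elim: (finmap.enum_fset _) => [_|y s ih ys].
    by under eq_fun do rewrite big_nil.
  under eq_fun do rewrite big_cons.
  have y0 : (0 <= y)%R by apply: ys; rewrite inE eqxx.
  have ys' z : z \in s -> (0 <= z)%R by move=> zs; apply: ys; rewrite inE zs orbT.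
  have mi z : measurable_fun setT (fun x => (\1_(g @^-1` [set z]) x)%:E : \bar R).
    exact/measurable_EFinP.
  apply: QD.
  - by move=> x; rewrite lee_fin mulr_ge0.
  - move=> x; rewrite big_seq sume_ge0// => z zs.
    by rewrite lee_fin mulr_ge0// ys'.
  - by under eq_fun do rewrite EFinM; exact: measurable_funeM.
  - apply: emeasurable_sum => z.
    by under eq_fun do rewrite EFinM; exact: measurable_funeM.
  - under eq_fun do rewrite EFinM; apply: QZ => //.
      exact: Q1.
  - exact: ih.
pose f_ := nnsfun_approx measurableT mf.
rewrite (_ : f = fun x => limn (fun n => (f_ n x)%:E)); last first.
  by apply/funext => x; apply/esym/cvg_lim => //; exact: cvg_nnsfun_approx.
apply: Qlim => //.
- by move=> n x; rewrite lee_fin.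
- by move=> n; exact/measurable_EFinP.
- by move=> x a b ab; rewrite lee_fin; exact/lefP/nd_nnsfun_approx.
Qed.

End functional_induction.

Section bounded_measurable.
Context d (T : measurableType d) (R : realType).
Implicit Types f g : T -> R.

(** The class in which the whole argument takes place: against a measure of mass
    1 such functions are integrable, so that the real-valued integral is linear
    and monotone on them without side conditions. *)
Definition bmeas f :=
  measurable_fun setT f /\ exists K : R, forall x, `|f x| <= K.

Lemma bmeas_meas f : bmeas f -> measurable_fun setT f. Proof. by case. Qed.

Lemma bmeas_bound f : bmeas f -> exists2 K : R, 1 <= K & forall x, `|f x| <= K.
Proof.
move=> [_ [K fK]]; exists (Num.max 1 K); first by rewrite le_max lexx.
by move=> x; rewrite le_max fK orbT.
Qed.

Lemma bmeas_cst (c : R) : bmeas (fun=> c).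
Proof. by split => //; exists `|c|. Qed.

Lemma bmeasD f g : bmeas f -> bmeas g -> bmeas (fun x => f x + g x).
Proof.
move=> [mf [K fK]] [mg [L gL]]; split; first exact: measurable_funD.
by exists (K + L) => x; rewrite (le_trans (ler_normD _ _))// lerD.
Qed.

Lemma bmeasN f : bmeas f -> bmeas (fun x => - f x).
Proof.
move=> [mf [K fK]]; split; first exact: measurableT_comp.
by exists K => x; rewrite normrN.
Qed.

Lemma bmeasB f g : bmeas f -> bmeas g -> bmeas (fun x => f x - g x).
Proof. by move=> bf /bmeasN; exact: bmeasD. Qed.

Lemma bmeasM f g : bmeas f -> bmeas g -> bmeas (fun x => f x * g x).
Proof.
move=> [mf [K fK]] [mg [L gL]]; split; first exact: measurable_funM.
by exists (K * L) => x; rewrite normrM ler_pM.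
Qed.

Lemma bmeasX f n : bmeas f -> bmeas (fun x => f x ^+ n).
Proof.
move=> bf; elim: n => [|n ih].
  by under eq_fun do rewrite expr0; exact: bmeas_cst.
by under eq_fun do rewrite exprS; exact: bmeasM.
Qed.

Lemma bmeas_norm f : bmeas f -> bmeas (fun x => `|f x|).
Proof.
move=> [mf [K fK]]; split; first exact: measurableT_comp.
by exists K => x; rewrite normr_id.
Qed.

Lemma bmeas_expR f : bmeas f -> bmeas (fun x => expR (f x)).
Proof.
move=> [mf [K fK]]; split; first exact: measurableT_comp.
exists (expR K) => x; rewrite ger0_norm ?expR_ge0// ler_expR.
exact: le_trans (ler_norm _) (fK x).
Qed.

Lemma bmeas_sum I (s : seq I) (F : I -> T -> R) :
  (forall i, bmeas (F i)) -> bmeas (fun x => \sum_(i <- s) F i x).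
Proof.
move=> bF; elim: s => [|i s ih].
  by under eq_fun do rewrite big_nil; exact: bmeas_cst.
by under eq_fun do rewrite big_cons; exact: bmeasD.
Qed.

Lemma bmeas_itv f a b : measurable_fun setT f ->
  (forall x, a <= f x <= b) -> bmeas f.
Proof.
move=> mf ab; split => //; exists (`|a| + `|b|) => x.
have /andP[ax xb] := ab x.
rewrite ler_norml; apply/andP; split.
  have := ler_norm (- a); have := normr_ge0 b; rewrite normrN; lra.
have := ler_norm b; have := normr_ge0 a; lra.
Qed.

Section unit_mass.
Variables (P : {measure set T -> \bar R}) (P1 : P setT = 1%E).

Lemma bmeas_integrable f : bmeas f -> P.-integrable setT (EFin \o f).
Proof.
move=> [mf [K fK]]; apply: measurable_bounded_integrable => //.
  by rewrite P1 ltry.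
by exists K; split; [exact: num_real|move=> M KM x _; exact: le_trans (fK x) (ltW KM)].
Qed.

Lemma EFin_Rintegral f : bmeas f ->
  (\int[P]_x f x)%:E = (\int[P]_x (f x)%:E)%E.
Proof.
by move=> bf; rewrite /Rintegral fineK//; apply: integrable_fin_num => //;
  exact: bmeas_integrable.
Qed.

Lemma bRintegralD f g : bmeas f -> bmeas g ->
  \int[P]_x (f x + g x) = \int[P]_x f x + \int[P]_x g x.
Proof. by move=> bf bg; rewrite RintegralD//; exact: bmeas_integrable. Qed.

Lemma bRintegralB f g : bmeas f -> bmeas g ->
  \int[P]_x (f x - g x) = \int[P]_x f x - \int[P]_x g x.
Proof. by move=> bf bg; rewrite RintegralB//; exact: bmeas_integrable. Qed.

Lemma bRintegralZl f c : bmeas f ->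
  \int[P]_x (c * f x) = c * \int[P]_x f x.
Proof. by move=> bf; rewrite RintegralZl//; exact: bmeas_integrable. Qed.

Lemma bRintegralZr f c : bmeas f ->
  \int[P]_x (f x * c) = (\int[P]_x f x) * c.
Proof. by move=> bf; rewrite RintegralZr//; exact: bmeas_integrable. Qed.

Lemma bRintegral_le f g : bmeas f -> bmeas g -> (forall x, f x <= g x) ->
  \int[P]_x f x <= \int[P]_x g x.
Proof. by move=> bf bg fg; apply: le_Rintegral => //; exact: bmeas_integrable. Qed.

Lemma bRintegral_norm f : bmeas f ->
  `|\int[P]_x f x| <= \int[P]_x `|f x|.
Proof. by move=> bf; apply: le_normr_Rintegral => //; exact: bmeas_integrable. Qed.

Lemma bRintegral_cst (c : R) : \int[P]_x c = c.
Proof. by rewrite Rintegral_cst// P1 /= mulr1. Qed.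

End unit_mass.

End bounded_measurable.

Lemma bmeas_comp d d' (T : measurableType d) (T' : measurableType d')
    (R : realType) (h : T' -> T) (f : T -> R) :
  measurable_fun setT h -> bmeas f -> bmeas (fun x => f (h x)).
Proof.
move=> mh [mf [K fK]]; split; first exact: (measurableT_comp mf).
by exists K => x.
Qed.

Ltac bm_step :=
  lazymatch goal with
  | |- bmeas (fun x => (@?f x + @?g x)%R) => refine (@bmeasD _ _ _ f g _ _)
  | |- bmeas (fun x => (- @?f x)%R) => refine (@bmeasN _ _ _ f _)
  | |- bmeas (fun x => (@?f x * @?g x)%R) => refine (@bmeasM _ _ _ f g _ _)
  | |- bmeas (fun x => (@?f x ^+ ?n)%R) => refine (@bmeasX _ _ _ f n _)
  | |- bmeas (fun x => (`|@?f x|)%R) => refine (@bmeas_norm _ _ _ f _)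
  | |- bmeas (fun x => expR (@?f x)) => refine (@bmeas_expR _ _ _ f _)
  end.
Ltac bm_leaf :=
  match goal with
  | H : bmeas ?f |- bmeas ?g => constr_eq f g; exact H
  | H : bmeas ?f |- bmeas (fun x => ?g x) => constr_eq f g; exact H
  | H : bmeas ?f |- bmeas ?g => constr_eq f (fun x => g x); exact H
  | |- _ => exact: bmeas_cst
  | |- _ => eassumption
  end.
Ltac bm := solve [intros; repeat bm_step; bm_leaf].

(** * The law of the process started from a distribution *)

Section initial_law.
Context (R : realType) (dE dO : measure_display).
Context (E : measurableType dE) (Omega : measurableType dO).
Variable P : R.-pker E ~> Omega.

(** Composition of kernels passes the first coordinate on to the second kernel;
    here this coordinate is a dummy of type unit. *)
Definition started (p : unit * E) : {measure set Omega -> \bar R} := P p.2.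

Let measurable_started U : measurable U ->
  measurable_fun setT (started ^~ U).
Proof.
by move=> mU; exact: (measurableT_comp (measurable_kernel P U mU)).
Qed.

HB.instance Definition _ :=
  isKernel.Build _ _ (unit * E)%type Omega R started measurable_started.

Let started_prob p : started p setT = 1%E.
Proof. exact: prob_kernel. Qed.

HB.instance Definition _ :=
  @Kernel_isProbability.Build _ _ _ _ R started started_prob.

Variable nu : probability E R.

(** The set function law_from, made into a probability measure so that Tonelli's
    theorem applies to it. *)
Definition path_law : set Omega -> \bar R :=
  mkcomp (kprobability (@measurable_cst _ _ unit (pprobability E R) setT nu)) started tt.

HB.instance Definition _ := Measure.on path_law.

Lemma path_lawE A : path_law A = law_from P nu A.
Proof. by []. Qed.

Lemma ge0_integral_path_law (f : Omega -> \bar R) :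
  (forall w, 0 <= f w)%E -> measurable_fun setT f ->
  (\int[path_law]_w f w = \int[nu]_x \int[P x]_w f w)%E.
Proof. by move=> f0 mf; rewrite /path_law integral_kcomp. Qed.

Lemma kernel1 x : P x setT = 1%E. Proof. exact: prob_kernel. Qed.

Lemma path_law1 : path_law setT = 1%E.
Proof.
rewrite path_lawE /law_from; under eq_integral do rewrite prob_kernel.
by rewrite integral_cst// mul1e; exact: probability_setT.
Qed.

HB.instance Definition _ :=
  Measure_isProbability.Build _ _ _ path_law path_law1.

Lemma bmeas_kernel (f : Omega -> R) : bmeas f ->
  bmeas (fun x => \int[P x]_w f w).
Proof.
move=> bf; have [K K1 fK] := bmeas_bound bf.
have K0 : 0 <= K by apply: le_trans K1.
have int x := bmeas_integrable (kernel1 x).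
split; last first.
  exists K => x; rewrite (le_trans (bRintegral_norm (kernel1 x) bf))//.
  rewrite -[leRHS](bRintegral_cst (kernel1 x)).
  by apply: bRintegral_le => //; [exact: kernel1|bm|bm].
rewrite (_ : (fun x => _) = fun x => (\int[P x]_w (f w + K)) - K); last first.
  apply/funext => x; rewrite (bRintegralD (kernel1 x))//; last bm.
  by rewrite (bRintegral_cst (kernel1 x)) addrK.
apply: measurable_funB => //; rewrite /Rintegral.
apply: measurableT_comp => //.
apply: measurable_fun_integral_kernel.
- by move=> U mU; exact: measurable_kernel.
- by move=> w; rewrite lee_fin; have := fK w; rewrite ler_norml; lra.
- by apply/measurable_EFinP/bmeas_meas; bm.
Qed.

(** Adding the bound of f reduces the claim to nonnegative functions. *)
Lemma Rintegral_path_law (f : Omega -> R) : bmeas f ->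
  \int[path_law]_w f w = \int[nu]_x \int[P x]_w f w.
Proof.
move=> bf; have [K K1 fK] := bmeas_bound bf.
have nu1 : nu setT = 1%E by exact: probability_setT.
have bg : bmeas (fun w => f w + K) by bm.
suff : \int[path_law]_w (f w + K) = \int[nu]_x \int[P x]_w (f w + K).
  rewrite (bRintegralD path_law1)//; last bm.
  rewrite (bRintegral_cst path_law1).
  under [in RHS]eq_Rintegral.
    move=> x _; rewrite (bRintegralD (kernel1 x))//; last bm.
    rewrite (bRintegral_cst (kernel1 x)); over.
  rewrite (bRintegralD nu1) ?(bRintegral_cst nu1); [|exact: bmeas_kernel|bm].
  exact: addIr.
rewrite {1}/Rintegral ge0_integral_path_law//; last 2 first.
- by move=> w; rewrite lee_fin; have := fK w; rewrite ler_norml; lra.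
- by apply/measurable_EFinP/bmeas_meas; bm.
rewrite /Rintegral; congr fine; apply: eq_integral => x _.
by rewrite -(EFin_Rintegral (kernel1 x)).
Qed.

End initial_law.

(** * The Markov property for functions *)

Section markov_property.
Context (R : realType) (dE dO : measure_display).
Context (E : measurableType dE) (Omega : measurableType dO).
Variables (X : R -> Omega -> E) (P : R.-pker E ~> Omega).
Hypothesis HX : markov_process X P.

Local Notation pt := (transition_semigroup X P).

(** Clipping the time at 0 turns joint measurability on a half-space into joint
    measurability on the whole product. *)
Lemma measurable_path_clip :
  measurable_fun setT (fun p : measurableTypeR R * Omega => X (Num.max 0 p.1) p.2).
Proof.
have [mX _ _] := HX.
apply: (measurable_comp (F := [set p : measurableTypeR R * Omega | 0 <= p.1 :> R])
  (f := fun p => X p.1 p.2)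
  (g := fun p : measurableTypeR R * Omega => (Num.max 0 p.1 : measurableTypeR R, p.2))) => //.
- rewrite -[X in measurable X]setTI.
  rewrite (_ : [set p | _] = fst @^-1` (`[0, +oo[%classic : set (measurableTypeR R))).
    by apply: measurable_fst => //; exact: measurable_itv.
  by apply/seteqP; split => p /=; rewrite in_itv/= andbT.
- by move=> _ [p _ <-] /=; rewrite le_max lexx.
- apply/measurable_fun_pairP; split => /=; last exact: measurable_snd.
  by apply: measurable_maxr; [exact: measurable_cst|exact: measurable_fst].
Qed.

Lemma measurable_path s : 0 <= s -> measurable_fun setT (X s).
Proof.
move=> s0; have := measurableT_comp measurable_path_clip (@pair1_measurable _ _ (measurableTypeR R) Omega s).
by congr measurable_fun; apply/funext => w /=; rewrite max_r.
Qed.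

Lemma measurable_integral_path (f : E -> \bar R) s t : 0 <= s -> 0 <= t ->
  (forall x, 0 <= f x)%E -> measurable_fun setT f ->
  measurable_fun setT (fun w => \int[P (X s w)]_v f (X t v))%E.
Proof.
move=> s0 t0 f0 mf.
apply: (measurableT_comp (f := fun x => (\int[P x]_v f (X t v))%E) _ (measurable_path s0)).
apply: measurable_fun_integral_kernel => //.
- by move=> A mA; exact: measurable_kernel.
- exact: (measurableT_comp mf (measurable_path t0)).
Qed.

Lemma bmeas_path (f : E -> R) s : 0 <= s -> bmeas f -> bmeas (fun w => f (X s w)).
Proof. by move=> s0; apply: bmeas_comp; exact: measurable_path. Qed.

Lemma bmeas_semigroup (f : E -> R) t : 0 <= t -> bmeas f -> bmeas (pt t f).
Proof. by move=> t0 bf; apply: bmeas_kernel; exact: bmeas_path. Qed.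

Lemma semigroup_ge0 (f : E -> R) t x : (forall y, 0 <= f y) -> 0 <= pt t f x.
Proof. by move=> f0; apply: Rintegral_ge0 => w _. Qed.

(** The sample space with the sigma-algebra of the past up to time s, as a
    measurable type, so that stability of measurable functions under products
    applies to adapted variables. *)
Definition filt (s : R) := g_sigma_algebraType
  (\bigcup_(u in `[0%R, s]) preimage_set_system setT (X u) measurable).

Definition adapted s (Y : Omega -> R) := measurable_fun (T := filt s) setT Y.

Lemma filt_measurable s (A : set Omega) :
  measurable (A : set (filt s)) -> measurable A.
Proof.
move=> FA; have : natural_filtration X s A by [].
apply: smallest_sub => //; first exact: sigma_algebra_measurable.
move=> B [u /=]; rewrite in_itv/= => /andP[u0 us] [C mC <-].
exact: measurable_path.
Qed.

Lemma adapted_measurable d (U : measurableType d) s (Y : Omega -> U) :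
  measurable_fun (T := filt s) setT Y -> measurable_fun setT Y.
Proof. by move=> mY _ B mB; exact: (filt_measurable (mY measurableT B mB)). Qed.

Lemma adapted_le s s' Y : s <= s' -> adapted s Y -> adapted s' Y.
Proof.
move=> ss' mY _ B mB; apply: sub_sigma_algebra2 (mY measurableT B mB).
move=> A [u /=]; rewrite in_itv/= => /andP[u0 us] [C mC <-].
by exists u; [rewrite /= in_itv/= u0 (le_trans us)|exists C].
Qed.

Lemma adapted_path s (f : E -> R) : 0 <= s -> measurable_fun setT f ->
  adapted s (fun w => f (X s w)).
Proof.
move=> s0 mf _ B mB; apply: sub_sigma_algebra.
exists s; first by rewrite /= in_itv/= s0 lexx.
by exists (f @^-1` B) => //; rewrite -[X in measurable X]setTI; exact: mf.
Qed.

(** The defining property, extended in the function of the later state. *)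
Lemma markov_set x s t (A : set Omega) (f : E -> \bar R) : 0 <= s -> 0 <= t ->
  natural_filtration X s A ->
  (forall y, 0 <= f y)%E -> measurable_fun setT f ->
  (\int[P x]_(w in A) f (X (s + t) w) =
   \int[P x]_(w in A) \int[P (X s w)]_v f (X t v))%E.
Proof.
move=> s0 t0 FA f0 mf.
have [_ _ MP] := HX.
have st0 : 0 <= s + t by exact: addr_ge0.
have mA : measurable A := filt_measurable FA.
have mXst (g : E -> \bar R) u : 0 <= u -> measurable_fun setT g ->
    forall D : set Omega, measurable_fun D (fun w => g (X u w)).
  move=> u0 mg D; apply: measurable_funTS.
  exact: (measurableT_comp mg (measurable_path u0)).
have mI (g : E -> \bar R) : (forall y, 0 <= g y)%E -> measurable_fun setT g ->
    measurable_fun A (fun w => \int[P (X s w)]_v g (X t v))%E.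
  by move=> g0 mg; apply: measurable_funTS; exact: measurable_integral_path.
move: f f0 mf; apply: ge0_measurable_ind.
- move=> B mB.
  have mXB u : 0 <= u -> measurable (X u @^-1` B).
    by move=> u0; rewrite -[X in measurable X]setTI; exact: measurable_path.
  rewrite (_ : (fun w => _) = (fun w => (\1_(X (s + t) @^-1` B) w)%:E))//.
  rewrite integral_indic//; last exact: mXB.
  rewrite setIC MP//; apply: eq_integral => w _.
  rewrite (_ : (fun v => _) = (fun v => (\1_(X t @^-1` B) v)%:E))//.
  by rewrite integral_indic ?setIT//; exact: mXB.
- move=> c f c0 f0 mf ih.
  rewrite ge0_integralZl//; last exact: mXst.
  under [in RHS]eq_integral.
    move=> w _; rewrite ge0_integralZl//; last exact: mXst.
    over.
  rewrite ge0_integralZl ?ih//; first exact: mI.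
  by move=> w _; exact: integral_ge0.
- move=> f g f0 g0 mf mg ihf ihg.
  rewrite ge0_integralD//; [|exact: mXst|exact: mXst].
  under [in RHS]eq_integral.
    move=> w _; rewrite ge0_integralD//; [|exact: mXst|exact: mXst]; over.
  rewrite ge0_integralD ?ihf ?ihg//.
  + by move=> w _; exact: integral_ge0.
  + exact: mI.
  + by move=> w _; exact: integral_ge0.
  + exact: mI.
- move=> f_ f0 mf ndf ih.
  rewrite (monotone_convergence _ mA (g' := fun n w => f_ n (X (s + t) w)))//; last first.
    by move=> n; exact: mXst.
  under [in RHS]eq_integral.
    move=> w _.
    rewrite (monotone_convergence _ measurableT (g' := fun n v => f_ n (X t v)))//; last first.
      by move=> n; exact: mXst.
    over.
  rewrite (monotone_convergence _ mA
    (g' := fun n w => \int[P (X s w)]_v f_ n (X t v))%E)//; last 3 first.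
    by move=> n; exact: mI.
    by move=> n w _; exact: integral_ge0.
    move=> w _ n m nm; apply: ge0_le_integral => //; [exact: mXst|exact: mXst|].
    by move=> v _; exact: ndf.
  by congr (limn _); apply/funext => n; exact: ih.
Qed.

(** The same, extended from events of the past to adapted weights. *)
Lemma markov x s t (Y : Omega -> R) (f : E -> R) : 0 <= s -> 0 <= t ->
  adapted s Y -> (forall w, 0 <= Y w) -> bmeas Y ->
  bmeas f -> (forall y, 0 <= f y) ->
  \int[P x]_w (Y w * f (X (s + t) w)) = \int[P x]_w (Y w * pt t f (X s w)).
Proof.
move=> s0 t0 aY Y0 bY bf f0.
have st0 : 0 <= s + t by exact: addr_ge0.
have b1 := bmeas_path st0 bf.
have b2 := bmeas_path s0 (bmeas_semigroup t0 bf).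
have m1 : measurable_fun setT (fun w => (f (X (s + t) w))%:E).
  by apply/measurable_EFinP/bmeas_meas.
have m2 : measurable_fun setT (fun w => (pt t f (X s w))%:E).
  by apply/measurable_EFinP/bmeas_meas.
have f2 y : 0 <= pt t f y by exact: semigroup_ge0.
have EY : measurable_fun (T := filt s) setT (EFin \o Y) by exact/measurable_EFinP.
have : forall y : filt s, (0 <= (EFin \o Y) y)%E by move=> w; rewrite lee_fin.
move: (EFin \o Y) EY => Ye mYe.
suff H : forall Ye : filt s -> \bar R, (forall y, 0 <= Ye y)%E ->
    measurable_fun setT Ye ->
    (\int[P x]_w (Ye w * (f (X (s + t) w))%:E) =
     \int[P x]_w (Ye w * (pt t f (X s w))%:E))%E.
  move=> _; rewrite /Rintegral; congr fine.
  under eq_integral do rewrite EFinM; under [in RHS]eq_integral do rewrite EFinM.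
  apply: (H (EFin \o Y)); first by move=> w; rewrite lee_fin.
  exact/measurable_EFinP.
move=> {Ye mYe}; apply: ge0_measurable_ind.
- move=> A FA.
  have mA : measurable (A : set Omega) := filt_measurable FA.
  have H (g : Omega -> R) : (\int[P x]_w ((\1_A w)%:E * (g w)%:E) =
      \int[P x]_(w in (A : set Omega)) (g w)%:E)%E.
    by rewrite [RHS]integral_mkcond epatch_indic; apply: eq_integral => w _ /=; rewrite muleC.
  rewrite !H (markov_set _ s0 t0 FA (f := EFin \o f))//.
  + apply: eq_integral => w _.
    by rewrite /transition_semigroup (EFin_Rintegral (kernel1 P _))//; exact: bmeas_path.
  + by apply/measurable_EFinP/bmeas_meas.
- move=> c g c0 g0 mg ih.
  under eq_integral do rewrite -muleA; under [in RHS]eq_integral do rewrite -muleA.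
  have mg' := adapted_measurable mg.
  rewrite !ge0_integralZl ?ih//.
  + exact: emeasurable_funM.
  + by move=> w _; rewrite mule_ge0 ?lee_fin.
  + exact: emeasurable_funM.
  + by move=> w _; rewrite mule_ge0 ?lee_fin.
- move=> g h g0 h0 mg mh ihg ihh.
  under eq_integral do rewrite ge0_muleDl//.
  under [in RHS]eq_integral do rewrite ge0_muleDl//.
  have mg' := adapted_measurable mg; have mh' := adapted_measurable mh.
  rewrite !ge0_integralD ?ihg ?ihh//; try exact: emeasurable_funM;
    by move=> w _; rewrite mule_ge0 ?lee_fin.
- move=> g_ g0 mg ndg ih.
  have cg w : cvgn (g_^~ w) by apply: ereal_nondecreasing_is_cvgn; exact: ndg.
  under eq_integral do rewrite -limeMr//.
  under [in RHS]eq_integral do rewrite -limeMr//.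
  have mg' n := adapted_measurable (mg n).
  rewrite (@monotone_convergence _ Omega R (P x) setT measurableT
    (fun n (w : Omega) => g_ n w * (f (X (s + t) w))%:E)%E); last 3 first.
    by move=> n; exact: emeasurable_funM.
    by move=> n w _; rewrite mule_ge0 ?lee_fin.
    by move=> w _ n m nm; rewrite lee_wpmul2r ?lee_fin//; exact: ndg.
  rewrite (@monotone_convergence _ Omega R (P x) setT measurableT
    (fun n (w : Omega) => g_ n w * (pt t f (X s w))%:E)%E); last 3 first.
    by move=> n; exact: emeasurable_funM.
    by move=> n w _; rewrite mule_ge0 ?lee_fin.
    by move=> w _ n m nm; rewrite lee_wpmul2r ?lee_fin//; exact: ndg.
  by congr (limn _); apply/funext => n; exact: ih.
Qed.

End markov_property.

(** * Finite-dimensional distributions *)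

Section finite_dimensional.
Context (R : realType) (dE dO : measure_display).
Context (E : measurableType dE) (Omega : measurableType dO).
Variables (X : R -> Omega -> E) (P : R.-pker E ~> Omega).
Hypothesis HX : markov_process X P.

Local Notation pt := (transition_semigroup X P).

(** The process starts at x; this is stated through a real function because
    singletons of the state space need not be measurable. *)
Lemma start_ae x (g : E -> R) : measurable_fun setT g ->
  {ae P x, forall w, g (X 0 w) = g x}.
Proof.
move=> mg; have [_ PX0 _] := HX.
have mB : measurable (g @^-1` (~` [set g x])).
  by rewrite -[X in measurable X]setTI; apply: mg => //; apply: measurableC.
exists (X 0 @^-1` (g @^-1` (~` [set g x]))); split.
- by rewrite -[X in measurable X]setTI; exact: (measurable_path HX (lexx 0) measurableT mB).
- by rewrite PX0// diracE memNset//= => /(_ erefl).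
- by move=> w.
Qed.

Lemma Rintegral_start x (h : Omega -> R) (g : E -> R) : bmeas h -> bmeas g ->
  \int[P x]_w (h w * g (X 0 w)) = (\int[P x]_w h w) * g x.
Proof.
move=> bh bg; rewrite -(bRintegralZr (kernel1 P x))// /Rintegral; congr fine.
have bg0 := bmeas_path HX (lexx 0) bg.
apply: ae_eq_integral => //.
- by apply/measurable_EFinP/bmeas_meas; bm.
- by apply/measurable_EFinP/bmeas_meas; bm.
- by apply: filterS (start_ae x bg.1) => w -> _.
Qed.

(** The expectation from y of the product of f over the states at times
    0, d, ..., (n - 1) d, computed by conditioning backwards in time. *)
Fixpoint chain (f : E -> R) (d : R) (n : nat) : E -> R :=
  if n is k.+1 then fun y => f y * pt d (chain f d k) y else fun=> 1.

Lemma bmeas_chain f d n : 0 <= d -> bmeas f -> bmeas (chain f d n).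
Proof.
move=> d0 bf; elim: n => [|n ih] /=; first bm.
by apply: bmeasM => //; exact: (bmeas_semigroup HX).
Qed.

Lemma chain_ge0 f d n y : (forall y, 0 <= f y) -> 0 <= chain f d n y.
Proof.
move=> f0; elim: n y => [|n ih] y //=.
by rewrite mulr_ge0//; exact: semigroup_ge0.
Qed.

Lemma bmeas_prod_path f d n s : 0 <= s -> 0 <= d -> bmeas f ->
  bmeas (R := R) (fun w => \prod_(k < n) f (X (s + k%:R * d) w)).
Proof.
move=> s0 d0 bf; elim: n => [|n ih].
  by under eq_fun do rewrite big_ord0; bm.
under eq_fun do rewrite big_ord_recr/=.
by apply: bmeasM => //; apply: (bmeas_path HX) => //; rewrite addr_ge0// mulr_ge0.
Qed.

(** The earliest factor is absorbed into the adapted weight, after which the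
    Markov property moves the rest of the product one step back. *)
Lemma markov_prod f d n x s (Y : Omega -> R) : 0 <= d -> 0 <= s ->
  adapted X s Y -> (forall w, 0 <= Y w) -> bmeas Y ->
  bmeas f -> (forall y, 0 <= f y) ->
  \int[P x]_w (Y w * \prod_(k < n) f (X (s + k%:R * d) w)) =
  \int[P x]_w (Y w * chain f d n (X s w)).
Proof.
move=> d0 + + + + bf f0; elim: n s Y => [|n ih] s Y s0 aY Y0 bY.
  by apply: eq_Rintegral => w _ /=; rewrite big_ord0.
have bfs := bmeas_path HX s0 bf.
(* the factor at time s joins the weight, the others start at s + d *)
transitivity (\int[P x]_w ((Y w * f (X s w)) *
    \prod_(k < n) f (X (s + d + k%:R * d) w))).
  apply: eq_Rintegral => w _; rewrite big_ord_recl/= mul0r addr0 mulrA.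
  congr (_ * _); apply: eq_bigr => i _; congr (f (X _ w)).
  by rewrite /bump/= natrD mulrDl mul1r addrA.
have aYf : adapted X s (fun w => Y w * f (X s w)).
  apply: measurable_funM => //; apply: adapted_path => //; exact: bmeas_meas.
have Yf0 w : 0 <= Y w * f (X s w) by rewrite mulr_ge0.
rewrite ih//; last 3 first.
- by rewrite addr_ge0.
- by apply: adapted_le aYf; rewrite lerDl.
- by bm.
rewrite (markov HX x s0 d0 aYf Yf0)//.
- by apply: eq_Rintegral => w _ /=; rewrite mulrA.
- by bm.
- exact: bmeas_chain.
- by move=> y; exact: chain_ge0.
Qed.

(** After time h the path is a fresh path started at X_h, as far as finitely many
    states can tell. *)
Lemma markov_prod_shift f d n x h : 0 <= d -> 0 <= h ->
  bmeas f -> (forall y, 0 <= f y) ->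
  \int[P x]_w (\prod_(k < n) f (X (h + k%:R * d) w)) =
  pt h (fun y => \int[P y]_w (\prod_(k < n) f (X (k%:R * d) w))) x.
Proof.
move=> d0 h0 bf f0.
have H s y : 0 <= s -> \int[P y]_w (\prod_(k < n) f (X (s + k%:R * d) w)) =
    \int[P y]_w chain f d n (X s w).
  move=> s0; have := @markov_prod f d n y s (fun=> 1) d0 s0.
  under eq_Rintegral do rewrite mul1r.
  under [in RHS]eq_Rintegral do rewrite mul1r.
  apply=> //; last bm.
  exact: measurable_cst.
rewrite H// /transition_semigroup; apply: eq_Rintegral => w _.
under [RHS]eq_Rintegral do under eq_bigr do rewrite -[_ * d]add0r.
rewrite H//; have bc := bmeas_chain n d0 bf.
have := @Rintegral_start (X h w) (fun=> 1) _ (bmeas_cst _ 1) bc.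
by rewrite (bRintegral_cst (kernel1 P _)) mul1r; under eq_Rintegral do rewrite mul1r.
Qed.

End finite_dimensional.

(** * Stationarity, the L2 generator and continuity in mean *)

Lemma Lnorm2_bmeas d (T : measurableType d) (R : realType)
    (mu : probability T R) (f : T -> R) : bmeas f ->
  ('N[mu]_2%:E[(fun x => (f x)%:E)] = (Num.sqrt (\int[mu]_x (f x ^+ 2)))%:E)%E.
Proof.
move=> bf; rewrite unlock.
under eq_integral.
  move=> x _; rewrite abse_EFin poweR_EFin powR_mulrn// real_normK ?num_real//.
  over.
rewrite -(EFin_Rintegral (probability_setT mu)); last bm.
by rewrite poweR_EFin powR12_sqrt//; apply: Rintegral_ge0 => x _; exact: sqr_ge0.
Qed.

(** Convergence to 0 in L2 norm as a statement on integrals of squares, the form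
    in which generators and strong continuity are handled below. *)
Lemma Lnorm2_cvg0P d (T : measurableType d) (R : realType)
    (mu : probability T R) (F : R -> T -> R) :
  (forall t, 0 < t -> bmeas (F t)) ->
  ('N[mu]_2%:E[(fun x => (F t x)%:E)]%E @[t --> 0^'+] --> 0%E) <->
  (forall e : R, 0 < e -> exists2 d : R, 0 < d &
     forall t : R, 0 < t -> t < d -> \int[mu]_x (F t x ^+ 2) <= e).
Proof.
move=> bF; split => [/fine_cvgP[_ /cvgrPdist_lt H] e e0|H].
  have /H : 0 < Num.sqrt e by rewrite sqrtr_gt0.
  move=> [b /= b0 bH]; exists b => // t t0 td.
  have := bH t; rewrite /ball/= sub0r normrN gtr0_norm// => /(_ td t0).
  rewrite (Lnorm2_bmeas mu (bF t t0)) /= distrC subr0 ger0_norm ?sqrtr_ge0//.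
  rewrite ltr_sqrt// => /ltW //.
apply/fine_cvgP; split.
  exists 1 => //= t _ t0; rewrite Lnorm2_bmeas//; exact: bF.
apply/cvgrPdist_le => e e0.
have [b b0 bH] := H (e ^+ 2) (exprn_gt0 _ e0).
exists b => //= t; rewrite /ball/= sub0r normrN => td t0.
rewrite gtr0_norm// in td.
rewrite /= (Lnorm2_bmeas mu (bF t t0)) /= distrC subr0 ger0_norm ?sqrtr_ge0//.
by rewrite -[leRHS](ger0_norm (ltW e0)) -(sqrtr_sqr e) ler_wsqrtr// bH.
Qed.

(** Integrate 2 |y| <= e + y^2 / e. *)
Lemma Rintegral_norm_le_sqr d (T : measurableType d) (R : realType)
    (P : {measure set T -> \bar R}) (f : T -> R) (e : R) :
  P setT = 1%E -> bmeas f -> 0 < e ->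
  \int[P]_x `|f x| <= (e + (\int[P]_x (f x ^+ 2)) / e) / 2.
Proof.
move=> P1 bf e0.
rewrite -[X in (X + _) / 2](bRintegral_cst P1) -(bRintegralZr P1); last bm.
rewrite -(bRintegralD P1) -?(bRintegralZr P1); [|bm..].
apply: bRintegral_le => //; [bm|bm|] => x.
rewrite ler_pdivlMr// -subr_ge0.
have -> : e + f x ^+ 2 / e - `|f x| * 2 = (e - `|f x|) ^+ 2 / e.
  by rewrite sqrrB real_normK ?num_real//; field; rewrite gt_eqF.
by rewrite divr_ge0 ?sqr_ge0// ltW.
Qed.

Section stationarity.
Context (R : realType) (dE dO : measure_display).
Context (E : measurableType dE) (Omega : measurableType dO).
Variables (X : R -> Omega -> E) (P : R.-pker E ~> Omega).
Hypothesis HX : markov_process X P.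
Variable mu : probability E R.
Hypothesis mu_inv : invariant_measure X P mu.

Local Notation pt := (transition_semigroup X P).
Local Notation Pmu := (path_law P mu).
Let Pmu1 : Pmu setT = 1%E := path_law1 P mu.
Let mu1 : mu setT = 1%E := probability_setT mu.

Lemma bmeas_Lfun2 (f : E -> R) : bmeas f -> f \in Lfun mu 2%:E.
Proof.
move=> bf; rewrite inE; apply/andP; split; first by rewrite inE; exact: bf.1.
by rewrite inE /finite_norm /= (Lnorm2_bmeas mu bf) ltry.
Qed.

Lemma bmeas_diff_quotient (g Lg : E -> R) (t : R) : 0 < t -> bmeas g -> bmeas Lg ->
  bmeas (fun x => (pt t g x - g x) / t - Lg x).
Proof. by move=> /ltW t0 bg bL; have := bmeas_semigroup HX t0 bg; bm. Qed.

Lemma L2_generatorP (g Lg : E -> R) : bmeas g -> bmeas Lg ->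
  L2_generator X P mu g Lg <->
  (forall e : R, 0 < e -> exists2 d : R, 0 < d & forall t : R, 0 < t -> t < d ->
     \int[mu]_x (((pt t g x - g x) / t - Lg x) ^+ 2) <= e).
Proof.
move=> bg bL; split => [[_ _]|H].
  by move/Lnorm2_cvg0P; apply => t t0; exact: bmeas_diff_quotient.
split; [exact: bmeas_Lfun2|exact: bmeas_Lfun2|].
by apply/Lnorm2_cvg0P => // t t0; exact: bmeas_diff_quotient.
Qed.

Lemma stationary_ge0 t (f : E -> \bar R) : 0 <= t ->
  (forall x, 0 <= f x)%E -> measurable_fun setT f ->
  (\int[Pmu]_w f (X t w) = \int[mu]_x f x)%E.
Proof.
move=> t0 f0 mf; have mX := measurable_path HX t0.
rewrite -[LHS](@ge0_integral_pushforward _ _ _ _ _ _ mX Pmu setT f)//.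
by apply: eq_measure_integral => A mA _; exact: mu_inv.
Qed.

Lemma stationary t (f : E -> R) : 0 <= t -> bmeas f ->
  \int[Pmu]_w f (X t w) = \int[mu]_x f x.
Proof.
move=> t0 bf; have [K K1 fK] := bmeas_bound bf.
have bX := bmeas_path HX t0 bf.
apply: (@addIr _ K).
rewrite -[X in _ + X = _](bRintegral_cst Pmu1) -[X in _ = _ + X](bRintegral_cst mu1).
rewrite -(bRintegralD Pmu1) -?(bRintegralD mu1); [|bm..].
rewrite /Rintegral (stationary_ge0 (f := fun x => (f x + K)%:E))//.
- by move=> x; rewrite lee_fin; have := fK x; rewrite ler_norml; lra.
- by apply/measurable_EFinP/bmeas_meas; bm.
Qed.

Lemma invariant_semigroup t (f : E -> R) : 0 <= t -> bmeas f ->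
  \int[mu]_x pt t f x = \int[mu]_x f x.
Proof.
move=> t0 bf; rewrite -(stationary t0 bf) Rintegral_path_law//.
exact: (bmeas_path HX).
Qed.

(** Expand the square: by stationarity both squares have the same expectation,
    and by the Markov property the cross term is the inner product of U and
    P_r U. *)
Lemma path_increment_sqr (U : E -> R) s r : 0 <= s -> 0 <= r ->
  bmeas U -> (forall x, 0 <= U x) ->
  \int[Pmu]_w ((U (X (s + r) w) - U (X s w)) ^+ 2) =
  2 * \int[mu]_x (U x * (U x - pt r U x)).
Proof.
move=> s0 r0 bU U0; have sr0 : 0 <= s + r by exact: addr_ge0.
have b1 := bmeas_path HX s0 bU; have b2 := bmeas_path HX sr0 bU.
have bP := bmeas_semigroup HX r0 bU.
have b3 := bmeas_path HX s0 bP.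
have H : \int[Pmu]_w (U (X s w) * U (X (s + r) w)) =
         \int[mu]_x (U x * pt r U x).
  rewrite Rintegral_path_law; last bm.
  under eq_Rintegral.
    move=> x _; rewrite (markov HX x s0 r0 (adapted_path s0 bU.1))//; over.
  rewrite -Rintegral_path_law; last bm.
  by rewrite (stationary (f := fun x => U x * pt r U x))//; bm.
transitivity (\int[Pmu]_w ((U (X (s + r) w) ^+ 2 + U (X s w) ^+ 2) -
    2 * (U (X s w) * U (X (s + r) w)))).
  by apply: eq_Rintegral => w _; ring.
rewrite (bRintegralB Pmu1); [|bm..].
rewrite (bRintegralD Pmu1); [|bm..].
rewrite (bRintegralZl Pmu1); last bm.
rewrite H (stationary sr0 (f := fun x => U x ^+ 2)); last bm.
rewrite (stationary s0 (f := fun x => U x ^+ 2)); last bm.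
under [in RHS]eq_Rintegral do rewrite mulrBr -expr2.
by rewrite (bRintegralB mu1); [ring|bm..].
Qed.

Hypothesis P_cont : L2_strongly_continuous X P mu.

Lemma semigroup_continuous (f : E -> R) : bmeas f ->
  forall e : R, 0 < e -> exists2 d : R, 0 < d &
    forall t : R, 0 < t -> t < d -> \int[mu]_x ((pt t f x - f x) ^+ 2) <= e.
Proof.
move=> bf; apply/Lnorm2_cvg0P.
  by move=> t /ltW t0; apply: bmeasB => //; exact: (bmeas_semigroup HX).
by apply: P_cont; exact: bmeas_Lfun2.
Qed.

(** The path is continuous in mean, uniformly in time, although nothing is known
    of individual paths. *)
Lemma path_increment (U : E -> R) : bmeas U -> (forall x, 0 <= U x) ->
  forall e : R, 0 < e -> exists2 d : R, 0 < d & forall s r : R, 0 <= s -> 0 <= r -> r < d ->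
    \int[Pmu]_w `|U (X (s + r) w) - U (X s w)| <= e.
Proof.
move=> bU U0 e e0; have [K K1 UK] := bmeas_bound bU.
have K0 : 0 < K by apply: lt_le_trans K1.
(* 2 K a / e = e balances the two halves of Rintegral_norm_le_sqr *)
pose a := e ^+ 2 / (2 * K).
have a0 : 0 < a by rewrite divr_gt0 ?exprn_gt0// mulr_gt0.
have [d d0 dH] := semigroup_continuous bU (exprn_gt0 2 a0).
exists d => // s r s0; rewrite le_eqVlt => /predU1P[<- _|r0 rd].
  by under eq_Rintegral do rewrite addr0 subrr normr0; rewrite (bRintegral_cst Pmu1) ltW.
have r0' := ltW r0.
have sr0 : 0 <= s + r by exact: addr_ge0.
have b1 := bmeas_path HX s0 bU; have b2 := bmeas_path HX sr0 bU.
have bP := bmeas_semigroup HX r0' bU.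
apply: (le_trans (Rintegral_norm_le_sqr Pmu1 _ e0)); first bm.
rewrite path_increment_sqr// ler_pdivrMr//.
suff : \int[mu]_x (U x * (U x - pt r U x)) <= K * a.
  move=> H; have -> : e * 2 = e + (2 * (K * a)) / e.
    by rewrite /a; field; rewrite !gt_eqF.
  by rewrite lerD2l ler_pM2r ?invr_gt0// ler_pM2l.
apply: (@le_trans _ _ (\int[mu]_x (K * `|pt r U x - U x|))).
  apply: bRintegral_le => //; [bm|bm|] => x.
  rewrite distrC (le_trans (ler_norm _))// normrM ler_wpM2r// .
rewrite (bRintegralZl mu1) ?ler_pM2l//; last bm.
apply: (le_trans (Rintegral_norm_le_sqr mu1 _ a0)); first bm.
rewrite ler_pdivrMr//.
have := dH _ r0 rd; rewrite -(ler_pM2r (x := a^-1)) ?invr_gt0//.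
rewrite expr2 mulfK ?gt_eqF//; lra.
Qed.

End stationarity.

(** * Time integrals along a path *)

Section tonelli.
Context (R : realType) d (T : measurableType d) (Q : probability T R).
Variables (D : set (measurableTypeR R)) (f : R -> T -> \bar R).
Hypothesis mD : measurable D.
Hypothesis f0 : (forall s w, 0 <= f s w)%E.
Hypothesis mf : measurable_fun setT (fun p : measurableTypeR R * T => f p.1 p.2).

Let g (p : measurableTypeR R * T) := (f p.1 p.2 * (\1_D p.1)%:E)%E.

Let g0 p : (0 <= g p)%E.
Proof. by rewrite mule_ge0// lee_fin. Qed.

Let mg : measurable_fun setT g.
Proof.
apply: emeasurable_funM => //; apply/measurable_EFinP.
exact: (measurableT_comp (f := (\1_D : measurableTypeR R -> R)) (measurable_indic mD) measurable_fst).
Qed.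

Let gE w : (\int[lebesgue_measure]_(s in D) f s w =
            \int[lebesgue_measure]_s g (s, w))%E.
Proof. by rewrite integral_mkcond epatch_indic. Qed.

Lemma measurable_time_integral :
  measurable_fun setT (fun w => \int[lebesgue_measure]_(s in D) f s w)%E.
Proof.
under eq_fun do rewrite gE.
exact: (measurable_fun_fubini_tonelli_G (m1 := @lebesgue_measure R) g mg g0).
Qed.

Lemma tonelli_time :
  (\int[Q]_w \int[lebesgue_measure]_(s in D) f s w =
   \int[lebesgue_measure]_(s in D) \int[Q]_w f s w)%E.
Proof.
under eq_integral do rewrite gE.
rewrite -(fubini_tonelli (m1 := @lebesgue_measure R) (m2 := Q) g mg g0).
rewrite [RHS]integral_mkcond epatch_indic; apply: eq_integral => s _ /=.
rewrite /g /=; have [sD|sD] := boolP (s \in D).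
  by rewrite indicE sD mule1; under eq_integral do rewrite mule1.
by rewrite indicE (negbTE sD) mule0 integral0_eq// => w _; rewrite mule0.
Qed.

End tonelli.

Section time_integral.
Context (R : realType).
Implicit Types (f : measurableTypeR R -> R) (a b c : R).

Lemma bmeas_itv_integrable f a b : bmeas f ->
  lebesgue_measure.-integrable `[a, b] (EFin \o f).
Proof.
move=> [mf [K fK]]; apply: measurable_bounded_integrable => //.
- rewrite [X in (X < _)%E](lebesgue_measure_itv `[a, b])/=; case: ifPn; rewrite ?ltry// -EFinD ltry.
- exact: measurable_funTS.
- by exists K; split; [exact: num_real|move=> L KL x _; exact: le_trans (fK x) (ltW KL)].
Qed.

Lemma Rintegral_itv_cst a b c : a <= b ->
  \int[lebesgue_measure]_(_ in `[a, b]) c = c * (b - a).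
Proof.
move=> ab; rewrite Rintegral_cst//= lebesgue_measure_itv lte_fin.
move: ab; rewrite le_eqVlt => /predU1P[->|->]//.
by rewrite ltxx subrr.
Qed.

Lemma Rintegral_itv_split f a c b : bmeas f -> a <= c -> c <= b ->
  \int[lebesgue_measure]_(s in `[a, b]) f s =
  \int[lebesgue_measure]_(s in `[a, c]) f s + \int[lebesgue_measure]_(s in `[c, b]) f s.
Proof.
move=> bf ac cb; apply/eqP; rewrite addrC -subr_eq; apply/eqP.
rewrite Rintegral_itvB ?bnd_simp//; last exact: bmeas_itv_integrable.
apply: Rintegral_itv_obnd_cbnd.
by apply: integrableS (bmeas_itv_integrable c b bf) => //; exact: subset_itv_oc_cc.
Qed.

Lemma Rintegral_itv_le f a b (c : R) : bmeas f -> a <= b -> (forall s, f s <= c) ->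
  \int[lebesgue_measure]_(s in `[a, b]) f s <= c * (b - a).
Proof.
move=> bf ab cf; rewrite -Rintegral_itv_cst//.
by apply: le_Rintegral => //; apply: bmeas_itv_integrable => //; bm.
Qed.

Lemma Rintegral_itv_dist f a b (c : R) : bmeas f -> a <= b ->
  `|\int[lebesgue_measure]_(s in `[a, b]) f s - c * (b - a)| <=
  \int[lebesgue_measure]_(s in `[a, b]) `|f s - c|.
Proof.
move=> bf ab; rewrite -Rintegral_itv_cst//.
rewrite -RintegralB//; [|exact: bmeas_itv_integrable|apply: bmeas_itv_integrable; bm].
by apply: le_normr_Rintegral => //; apply: bmeas_itv_integrable; bm.
Qed.

End time_integral.

Section additive_functional.
Context (R : realType) (dE dO : measure_display).
Context (E : measurableType dE) (Omega : measurableType dO).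
Variables (X : R -> Omega -> E) (P : R.-pker E ~> Omega).
Hypothesis HX : markov_process X P.
Variable mu : probability E R.
Hypothesis mu_inv : invariant_measure X P mu.
Hypothesis P_cont : L2_strongly_continuous X P mu.

Local Notation pt := (transition_semigroup X P).
Local Notation Pmu := (path_law P mu).
Let Pmu1 : Pmu setT = 1%E := path_law1 P mu.
Let mu1 : mu setT = 1%E := probability_setT mu.

Variables (U : E -> R) (M : R).
Hypothesis mU : measurable_fun setT U.
Hypothesis U0M : forall x, 0 <= U x <= M.

Let U0 x : 0 <= U x. Proof. by have /andP[] := U0M x. Qed.
Let UM x : U x <= M. Proof. by have /andP[] := U0M x. Qed.
Let bU : bmeas U := bmeas_itv mU U0M.

(** The additive functional of V over the window [a, b]; the clipped time makes
    it measurable for all a and b. *)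
Definition afun (V : E -> R) (a b : R) (w : Omega) : R :=
  \int[lebesgue_measure]_(s in `[a, b]) V (X (Num.max 0 s) w).

Local Notation Z := (afun U).

Lemma bmeas_time (V : E -> R) w : bmeas V ->
  bmeas (fun s : measurableTypeR R => V (X (Num.max 0 s) w)).
Proof.
move=> bV.
apply: (bmeas_comp (f := V) (h := fun s : measurableTypeR R => X (Num.max 0 s) w)) => //.
exact: (measurableT_comp (measurable_path_clip HX) (@pair2_measurable _ _ (measurableTypeR R) Omega w)).
Qed.

Lemma afun_ge0 a b w : 0 <= Z a b w.
Proof. exact: Rintegral_ge0. Qed.

Lemma afun_le a b w : a <= b -> Z a b w <= M * (b - a).
Proof. by move=> ab; apply: Rintegral_itv_le => //; exact: bmeas_time. Qed.

Lemma afun_split a c b w : a <= c -> c <= b -> Z a b w = Z a c w + Z c b w.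
Proof. by move=> ac cb; apply: Rintegral_itv_split => //; exact: bmeas_time. Qed.

Lemma bmeas_afun a b : a <= b -> bmeas (Z a b).
Proof.
move=> ab; apply: (@bmeas_itv _ _ _ _ 0 (M * (b - a))); last first.
  by move=> w; rewrite afun_ge0 afun_le.
apply: measurableT_comp => //.
apply: (measurable_time_integral (f := fun s w => (U (X (Num.max 0 s) w))%:E)) => //.
- by move=> s w; rewrite lee_fin.
- by apply/measurable_EFinP; exact: (measurableT_comp mU (measurable_path_clip HX)).
Qed.

(** Average path_increment over the window, exchanging the integrals by
    Tonelli's theorem. *)
Lemma afun_modulus (e : R) : 0 < e -> exists2 d : R, 0 < d &
  forall s h : R, 0 <= s -> 0 <= h -> h < d ->
    \int[Pmu]_w `|Z s (s + h) w - h * U (X s w)| <= e * h.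
Proof.
move=> e0; have [d d0 dH] := path_increment HX mu_inv P_cont bU U0 e0.
exists d => // s h s0 h0 hd.
have sh : s <= s + h by rewrite lerDl.
have bs := bmeas_path HX s0 bU.
have bZ := bmeas_afun sh.
have mj : measurable_fun setT (fun p : measurableTypeR R * Omega =>
    `|U (X (Num.max 0 p.1) p.2) - U (X s p.2)|).
  apply: measurableT_comp => //; apply: measurable_funB.
    exact: (measurableT_comp mU (measurable_path_clip HX)).
  exact: (measurableT_comp bs.1 measurable_snd).
rewrite -lee_fin (EFin_Rintegral Pmu1); last bm.
apply: (@le_trans _ _ (\int[path_law P mu]_w
   \int[lebesgue_measure]_(r in `[s, (s + h)%R])
     (`|U (X (Num.max 0 r) w) - U (X s w)|)%:E)%E).
  apply: ge0_le_integral => //.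
  - by apply/measurable_EFinP/bmeas_meas; bm.
  - apply: (measurable_time_integral
      (f := fun r w => (`|U (X (Num.max 0 r) w) - U (X s w)|)%:E)) => //.
    exact/measurable_EFinP.
  - move=> w _; have bt := bmeas_time w bU.
    have -> : h * U (X s w) = U (X s w) * ((s + h) - s) by ring.
    rewrite (le_trans (y := (\int[lebesgue_measure]_(r in `[s, s + h])
      `|U (X (Num.max 0 r) w) - U (X s w)|)%:E))//.
      by rewrite lee_fin; exact: Rintegral_itv_dist.
    rewrite /Rintegral fineK//; apply: integrable_fin_num => //.
    by apply: (bmeas_itv_integrable (f := fun r => `|U (X (Num.max 0 r) w) - U (X s w)|)); bm.
rewrite (tonelli_time (path_law P mu)
  (f := fun r w => (`|U (X (Num.max 0 r) w) - U (X s w)|)%:E))//; last first.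
  exact/measurable_EFinP.
apply: (@le_trans _ _ (\int[lebesgue_measure]_(r in `[s, (s + h)%R]) e%:E)%E).
  apply: ge0_le_integral => //.
  - by move=> r _; apply: integral_ge0 => w _; rewrite lee_fin.
  - apply: measurable_funTS.
    apply: (measurable_fun_fubini_tonelli_F (m2 := path_law P mu)
      (fun p : measurableTypeR R * Omega => (`|U (X (Num.max 0 p.1) p.2) - U (X s p.2)|)%:E)) => //.
    exact/measurable_EFinP.
  - move=> r /=; rewrite in_itv/= => /andP[sr rsh].
    have r0 : 0 <= r by exact: le_trans sr.
    have br := bmeas_path HX r0 bU.
    rewrite max_r// -(EFin_Rintegral Pmu1); last bm.
    rewrite lee_fin; have := dH s (r - s) s0; rewrite [s + _]addrC subrK; apply.
      by rewrite subr_ge0.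
    by rewrite ltrBlDl (le_lt_trans rsh)// ltrD2l.
rewrite integral_cst//= lebesgue_measure_itv lte_fin.
case: ifPn => _; first by rewrite -EFinD -EFinM lee_fin addrC addKr.
by rewrite mule0 lee_fin mulr_ge0// ltW.
Qed.

End additive_functional.

(** * The Feynman-Kac function *)

Lemma expR_dist (R : realType) (a b K : R) : a <= K -> b <= K ->
  `|expR a - expR b| <= expR K * `|a - b|.
Proof.
wlog ab : a b / b <= a => [H aK bK|aK _].
  have [ba|/ltW ab] := leP b a; first exact: H.
  by rewrite distrC [X in _ <= _ * X]distrC H.
rewrite !ger0_norm ?subr_ge0 ?ler_expR//.
apply: (@le_trans _ _ (expR a * (a - b))).
  have -> : expR a - expR b = expR a * (1 - expR (b - a)).
    by rewrite mulrBr mulr1 -expRD [a + _]addrC subrK.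
  rewrite ler_pM2l ?expR_gt0//; have := expR_ge1Dx (b - a); lra.
by rewrite ler_wpM2r ?subr_ge0// ler_expR.
Qed.

Lemma expR_taylor1 (R : realType) (x : R) : x <= 1 / 2 ->
  `|expR x - 1 - x| <= 2 * x ^+ 2.
Proof.
move=> x2; have x1 : 0 < 1 - x by lra.
have le1 := expR_ge1Dx x.
have le2 : expR x * (1 - x) <= 1.
  rewrite -(ler_pM2l (expR_gt0 (- x))) mulrA -expRD addNr expR0 mul1r mulr1.
  exact: expR_ge1Dx.
rewrite ger0_norm; last lra.
rewrite -(ler_pM2r x1); nra.
Qed.

Section feynman_kac.
Context (R : realType) (dE dO : measure_display).
Context (E : measurableType dE) (Omega : measurableType dO).
Variables (X : R -> Omega -> E) (P : R.-pker E ~> Omega).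
Hypothesis HX : markov_process X P.
Variable mu : probability E R.
Hypothesis mu_inv : invariant_measure X P mu.
Hypothesis P_cont : L2_strongly_continuous X P mu.

Local Notation pt := (transition_semigroup X P).
Local Notation Pmu := (path_law P mu).
Let Pmu1 : Pmu setT = 1%E := path_law1 P mu.
Let mu1 : mu setT = 1%E := probability_setT mu.

(** Conditional expectations contract L1 distances. *)
Lemma kernel_L1_dist (f g : Omega -> R) : bmeas f -> bmeas g ->
  \int[mu]_x `|\int[P x]_w f w - \int[P x]_w g w| <= \int[Pmu]_w `|f w - g w|.
Proof.
move=> bf bg; rewrite Rintegral_path_law; last bm.
have := bmeas_kernel P bf; have := bmeas_kernel P bg => b1 b2.
have b3 : bmeas (fun x => \int[P x]_w `|f w - g w|) by apply: bmeas_kernel; bm.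
apply: bRintegral_le => //; [bm|] => x.
rewrite -(bRintegralB (kernel1 P x))//.
by apply: (bRintegral_norm (kernel1 P x)); bm.
Qed.

Variables (U : E -> R) (M : R).
Hypothesis mU : measurable_fun setT U.
Hypothesis U0M : forall x, 0 <= U x <= M.

Let U0 x : 0 <= U x. Proof. by have /andP[] := U0M x. Qed.
Let UM x : U x <= M. Proof. by have /andP[] := U0M x. Qed.
Let bU : bmeas U := bmeas_itv mU U0M.

Local Notation Z := (afun X U).
Let bZ a b : a <= b -> bmeas (Z a b). Proof. exact: (bmeas_afun HX mU U0M). Qed.
Let Z0 a b w : 0 <= Z a b w. Proof. exact: (afun_ge0 X U0M). Qed.
Let ZM a b w : a <= b -> Z a b w <= M * (b - a).
Proof. exact: (afun_le HX mU U0M). Qed.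
Let ZS a c b w : a <= c -> c <= b -> Z a b w = Z a c w + Z c b w.
Proof. exact: (afun_split HX mU U0M). Qed.
Let bX s : 0 <= s -> bmeas (fun w => U (X s w)).
Proof. by move=> s0; exact: (bmeas_path HX). Qed.

Lemma riemann_sum_dist (e : R) : 0 < e -> exists2 d : R, 0 < d &
  forall (s h : R) n, 0 <= s -> 0 <= h -> h < d ->
    \int[Pmu]_w `|Z s (s + n%:R * h) w - \sum_(k < n) h * U (X (s + k%:R * h) w)|
      <= e * (n%:R * h).
Proof.
move=> e0; have [d d0 dH] := afun_modulus HX mu_inv P_cont mU U0M e0.
exists d => // s h n s0 h0 hd.
have skh k : s <= s + k%:R * h by rewrite lerDl mulr_ge0.
have skh0 k : 0 <= s + k%:R * h by exact: le_trans (skh k).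
have bS m : bmeas (fun w => \sum_(k < m) h * U (X (s + k%:R * h) w)).
  by apply: bmeas_sum => k; apply: bmeasM; [bm|exact: bX].
have bZs m : bmeas (Z s (s + m%:R * h)) by exact: bZ.
elim: n => [|n ih].
  rewrite mul0r mulr0 addr0.
  under eq_Rintegral do rewrite big_ord0 subr0 ger0_norm//.
  rewrite -(bRintegral_cst Pmu1 0); apply: bRintegral_le => //; [exact: bZ|bm|].
  by move=> w; have := ZM w (lexx s); rewrite subrr mulr0.
have snE : s + n.+1%:R * h = s + n%:R * h + h by rewrite -natr1; ring.
have H : \int[Pmu]_w `|Z (s + n%:R * h) (s + n%:R * h + h) w - h * U (X (s + n%:R * h) w)| <= e * h.
  exact: dH.
have b1 : bmeas (Z (s + n%:R * h) (s + n%:R * h + h)) by apply: bZ; rewrite lerDl.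
have b2 := bX (skh0 n).
have b3 : bmeas (Z s (s + n%:R * h + h)) by rewrite -snE; exact: bZs.
have b4 := bZs n.
have -> : e * (n.+1%:R * h) = e * (n%:R * h) + e * h by rewrite -natr1; ring.
apply: le_trans (lerD ih H).
rewrite -(bRintegralD Pmu1); [|by have := bS n; bm|bm].
apply: bRintegral_le => //.
- by have := bS n.+1; rewrite snE; bm.
- by have := bS n; bm.
move=> w; rewrite snE (@ZS s (s + n%:R * h))//; last by rewrite lerDl.
rewrite big_ord_recr/=; apply: le_trans (ler_normD _ _).
by rewrite le_eqVlt; apply/predU1P; left; congr (`|_|); ring.
Qed.

Definition fk (t : R) (x : E) : R := \int[P x]_w expR (Z 0 t w).

Lemma bmeas_fk (t : R) : 0 <= t -> bmeas (fk t).
Proof. by move=> t0; apply: bmeas_kernel; have := bZ t0; bm. Qed.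

(** Riemann sums turn the exponential functional into a product over finitely
    many states.  Mesh and number of steps do not depend on the start s of the
    window, which allows the same discretisation before and after a shift. *)
Lemma exp_riemann (t e : R) : 0 <= t -> 0 < e -> exists (n : nat) (h : R), 0 <= h /\
  forall s, 0 <= s ->
    \int[Pmu]_w `|expR (Z s (s + t) w) -
       \prod_(k < n) expR (h * U (X (s + k%:R * h) w))| <= e.
Proof.
move=> t0 e0; pose K := expR (M * t).
have K0 : 0 < K by exact: expR_gt0.
pose a := e / (K * (t + 1)).
have t1 : 0 < t + 1 by lra.
have a0 : 0 < a by rewrite divr_gt0// mulr_gt0.
have [d d0 dH] := riemann_sum_dist a0.
pose n := (Num.truncn (t / d)).+1.
have tn : t / d < n%:R.
  by have := truncnS_gt (t / d).
have n0 : 0 < n%:R :> R by rewrite ltr0n.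
exists n, (t / n%:R); split; first by rewrite divr_ge0.
move=> s s0.
have nh : n%:R * (t / n%:R) = t by rewrite mulrC divfK// gt_eqF.
have h0 : 0 <= t / n%:R by rewrite divr_ge0.
have hd : t / n%:R < d.
  by rewrite ltr_pdivrMr// mulrC -ltr_pdivrMr.
have skh0 k : 0 <= s + k%:R * (t / n%:R) by rewrite addr_ge0// mulr_ge0.
have bS : bmeas (fun w => \sum_(k < n) (t / n%:R) * U (X (s + k%:R * (t / n%:R)) w)).
  by apply: bmeas_sum => k; apply: bmeasM; [bm|exact: bX].
have b1 : bmeas (Z s (s + t)) by apply: bZ; rewrite lerDl.
have := dH s _ n s0 h0 hd; rewrite nh => H.
apply: (@le_trans _ _ (K * (a * t))); last first.
  rewrite /a; have -> : K * (e / (K * (t + 1)) * t) = e * (t / (t + 1)).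
    by field; rewrite !gt_eqF.
  by rewrite ler_piMr ?ltW// ltr_pdivrMr// mul1r ltrDl.
apply: (@le_trans _ _ (K * \int[Pmu]_w `|Z s (s + t) w - \sum_(k < n) (t / n%:R) * U (X (s + k%:R * (t / n%:R)) w)|)); last first.
  by rewrite ler_pM2l.
rewrite -(bRintegralZl Pmu1); last bm.
under eq_Rintegral do rewrite -expR_sum.
apply: bRintegral_le => //; [bm|bm|] => w.
apply: expR_dist.
  by have := @ZM s (s + t) w; rewrite addrAC subrr add0r; apply; rewrite lerDl.
have -> : M * t = \sum_(k < n) (t / n%:R) * M.
  by rewrite sumr_const card_ord -[RHS]mulr_natl mulrA nh mulrC.
by apply: ler_sum => k _; rewrite ler_wpM2l.
Qed.

(** Applying P_h slides the window of integration by h.  The identity holds for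
    products over finitely many states by markov_prod_shift, and passes to the
    limit in L1(mu) by exp_riemann and the invariance of mu. *)
Lemma semigroup_fk (h t : R) : 0 <= h -> 0 <= t ->
  \int[mu]_x `|pt h (fk t) x - \int[P x]_w expR (Z h (h + t) w)| = 0.
Proof.
move=> h0 t0.
have bt := bmeas_fk t0.
have b1 := bmeas_semigroup HX h0 bt.
have bZh : bmeas (Z h (h + t)) by apply: bZ; rewrite lerDl.
have b2 : bmeas (fun x => \int[P x]_w expR (Z h (h + t) w)) by apply: bmeas_kernel; bm.
apply/eqP; rewrite eq_le Rintegral_ge0// andbT.
apply/ler_addgt0Pr => e e0; rewrite add0r.
have [n [d [d0 H]]] := exp_riemann t0 (divr_gt0 e0 (ltr0n R 2)).
pose f := fun y => expR (d * U y).
have bf : bmeas f by rewrite /f; bm.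
have f0 y : 0 <= f y by exact: expR_ge0.
have bpr s : 0 <= s -> bmeas (R := R) (fun w => \prod_(k < n) f (X (s + k%:R * d) w)).
  by move=> s0; exact: (bmeas_prod_path HX).
pose A x := \int[P x]_w (\prod_(k < n) f (X (k%:R * d) w)).
have bpr0 : bmeas (R := R) (fun w => \prod_(k < n) f (X (k%:R * d) w)).
  by have := bpr 0 (lexx 0); under eq_fun do under eq_bigr do rewrite add0r.
have bA : bmeas A by apply: bmeas_kernel.
have b3 := bmeas_semigroup HX h0 bA.
have AE x : pt h A x = \int[P x]_w (\prod_(k < n) f (X (h + k%:R * d) w)).
  by rewrite (markov_prod_shift HX n x d0 h0 bf f0).
have H0 : \int[Pmu]_w `|expR (Z 0 t w) - \prod_(k < n) f (X (k%:R * d) w)| <= e / 2.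
  have := H 0 (lexx 0); rewrite add0r.
  by under eq_Rintegral do under eq_bigr do rewrite add0r.
have H1 : \int[mu]_x `|pt h (fk t) x - pt h A x| <= e / 2.
  apply: (@le_trans _ _ (\int[mu]_x pt h (fun y => `|fk t y - A y|) x)).
    have b4 : bmeas (fun y => `|fk t y - A y|) by bm.
    have b5 := bmeas_semigroup HX h0 b4.
    apply: bRintegral_le => //; [bm|] => x.
    rewrite /transition_semigroup -(bRintegralB (kernel1 P x)); last 2 first.
    - exact: (bmeas_path HX).
    - exact: (bmeas_path HX).
    apply: (bRintegral_norm (kernel1 P x)).
    by apply: (bmeas_path HX (f := fun y => fk t y - A y)) => //; bm.
  rewrite (invariant_semigroup HX mu_inv h0); last bm.
  apply: le_trans H0.
  by apply: kernel_L1_dist => //; have := bZ t0; bm.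
have H2 : \int[mu]_x `|pt h A x - \int[P x]_w expR (Z h (h + t) w)| <= e / 2.
  apply: le_trans (H h h0).
  under eq_Rintegral do rewrite distrC AE.
  by apply: kernel_L1_dist; [bm|exact: bpr].
have -> : e = e / 2 + e / 2 by field.
apply: le_trans (lerD H1 H2).
rewrite -(bRintegralD mu1); [|bm..].
apply: bRintegral_le => //; [bm|bm|] => x.
exact: ler_distD.
Qed.

End feynman_kac.

(** * Its generator and its growth in L2 *)

Lemma square_increment_le (R : realType) (h K D p q r : R) :
  0 <= q <= K -> `|p - q| <= D ->
  p ^+ 2 <= q ^+ 2 + (2 * h * (r * q) + (2 * K * `|p - q - h * r| + D ^+ 2)).
Proof.
move=> /andP[q0 qK] pqD.
have -> : p ^+ 2 = q ^+ 2 + (2 * h * (r * q) +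
    (2 * q * (p - q - h * r) + (p - q) ^+ 2)) by ring.
rewrite !lerD2l; apply: lerD.
  rewrite (le_trans (ler_norm _))// normrM ler_wpM2r// ger0_norm ?mulr_ge0//.
  by rewrite ler_pM2l.
rewrite -[leLHS]real_normK ?num_real// lerXn2r// nnegrE//.
exact: le_trans pqD.
Qed.

Section feynman_kac_generator.
Context (R : realType) (dE dO : measure_display).
Context (E : measurableType dE) (Omega : measurableType dO).
Variables (X : R -> Omega -> E) (P : R.-pker E ~> Omega).
Hypothesis HX : markov_process X P.
Variable mu : probability E R.
Hypothesis mu_inv : invariant_measure X P mu.
Hypothesis P_cont : L2_strongly_continuous X P mu.

Local Notation pt := (transition_semigroup X P).
Local Notation Pmu := (path_law P mu).
Let Pmu1 : Pmu setT = 1%E := path_law1 P mu.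
Let mu1 : mu setT = 1%E := probability_setT mu.

Variables (U : E -> R) (M : R).
Hypothesis mU : measurable_fun setT U.
Hypothesis M1 : 1 <= M.
Hypothesis U0M : forall x, 0 <= U x <= M.

Let M0 : 0 < M. Proof. exact: lt_le_trans M1. Qed.
Let U0 x : 0 <= U x. Proof. by have /andP[] := U0M x. Qed.
Let UM x : U x <= M. Proof. by have /andP[] := U0M x. Qed.
Let bU : bmeas U := bmeas_itv mU U0M.

Local Notation Z := (afun X U).
Local Notation u := (fk X P U).
Let bZ a b : a <= b -> bmeas (Z a b). Proof. exact: (bmeas_afun HX mU U0M). Qed.
Let Z0 a b w : 0 <= Z a b w. Proof. exact: (afun_ge0 X U0M). Qed.
Let ZM a b w : a <= b -> Z a b w <= M * (b - a).
Proof. exact: (afun_le HX mU U0M). Qed.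
Let ZS a c b w : a <= c -> c <= b -> Z a b w = Z a c w + Z c b w.
Proof. exact: (afun_split HX mU U0M). Qed.
Let bX s : 0 <= s -> bmeas (fun w => U (X s w)).
Proof. by move=> s0; exact: (bmeas_path HX). Qed.
Let bu t : 0 <= t -> bmeas (u t). Proof. exact: (bmeas_fk HX mU U0M). Qed.
Let Zh s h w : 0 <= h -> Z s (s + h) w <= M * h.
Proof. by move=> h0; have := @ZM s (s + h) w; rewrite addrAC subrr add0r; apply; rewrite lerDl. Qed.
Let Zt t w : 0 <= t -> Z 0 t w <= M * t.
Proof. by move=> t0; have := @Zh 0 t w t0; rewrite add0r. Qed.
Let bexpZ a b : a <= b -> bmeas (fun w => expR (Z a b w)).
Proof. by move=> ab; have := bZ ab; bm. Qed.

Let Zshift t h w : 0 <= t -> 0 <= h ->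
  Z h (t + h) w = Z 0 t w + (Z t (t + h) w - Z 0 h w).
Proof.
move=> t0 h0; rewrite addrA -ZS ?lerDl// (@ZS 0 h)// ?lerDr//.
by rewrite addrAC subrr add0r.
Qed.
Let Zdiff t h w : 0 <= h -> `|Z t (t + h) w - Z 0 h w| <= M * h.
Proof.
move=> h0; rewrite ler_norml; have := Zh t w h0; have := Z0 t (t + h) w.
by have := Zt w h0; have := Z0 0 h w; lra.
Qed.

Lemma fk_ge1 t x : 0 <= t -> 1 <= u t x.
Proof.
move=> t0; rewrite -(bRintegral_cst (kernel1 P x) 1).
apply: (bRintegral_le (kernel1 P x)); [bm|exact: bexpZ|] => w.
by rewrite -expR0 ler_expR.
Qed.

Lemma fk_le t x : 0 <= t -> u t x <= expR (M * t).
Proof.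
move=> t0; rewrite -(bRintegral_cst (kernel1 P x) (expR (M * t))).
apply: (bRintegral_le (kernel1 P x)); [exact: bexpZ|bm|] => w.
by rewrite ler_expR Zt.
Qed.

Lemma fk0 x : u 0 x = 1.
Proof.
rewrite -[RHS](bRintegral_cst (kernel1 P x)); apply: eq_Rintegral => w _.
suff -> : Z 0 0 w = 0 by rewrite expR0.
by apply/eqP; rewrite eq_le Z0 andbT (le_trans (Zt w (lexx 0)))// mulr0.
Qed.

Lemma expR_first_order (K d h c : R) (z : R) : 0 <= h -> 0 <= K -> h * M <= 1 / 2 ->
  `|d| <= M * h -> expR z <= K ->
  `|expR (z + d) - expR z - h * (expR z * c)| <= K * (2 * (M * h) ^+ 2 + `|d - h * c|).
Proof.
move=> h0 K0 hM dM zK.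
have dl : d <= 1 / 2 by rewrite (le_trans (ler_norm d))// (le_trans dM)// mulrC.
have -> : expR (z + d) - expR z - h * (expR z * c) =
    expR z * ((expR d - 1 - d) + (d - h * c)) by rewrite expRD; ring.
rewrite normrM (ger0_norm (expR_ge0 z)) ler_pM// ?expR_ge0//.
rewrite (le_trans (ler_normD _ _))// lerD2r (le_trans (expR_taylor1 dl))//.
by rewrite ler_pM2l// -[d ^+ 2]real_normK ?num_real// lerXn2r// nnegrE ?mulr_ge0// ltW.
Qed.

(** First order expansions for the two ways of moving the window: prolonging it
    by h, which brings in U(X_t), and sliding it by h, which also drops U(X_0).
    Stationarity makes the error uniform in t. *)
Lemma first_order_L1 (T e : R) : 0 < e -> exists2 d : R, 0 < d &
  forall t h : R, 0 <= t -> t <= T -> 0 <= h -> h < d ->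
   \int[Pmu]_w `|expR (Z 0 (t + h) w) - expR (Z 0 t w) -
      h * (expR (Z 0 t w) * U (X t w))| <= e * h /\
   \int[Pmu]_w `|expR (Z h (t + h) w) - expR (Z 0 t w) -
      h * (expR (Z 0 t w) * (U (X t w) - U (X 0 w)))| <= e * h.
Proof.
move=> e0; pose K := expR (M * T).
have K0 : 0 < K by exact: expR_gt0.
pose a := e / (4 * K).
have a0 : 0 < a by rewrite divr_gt0// mulr_gt0.
have [d d0 dH] := afun_modulus HX mu_inv P_cont mU U0M a0.
pose b := e / (4 * K * M ^+ 2).
have b0 : 0 < b by rewrite divr_gt0// !mulr_gt0// exprn_gt0.
exists (Num.min d (Num.min b (1 / (2 * M)))).
  by rewrite !lt_min d0 b0 divr_gt0// mulr_gt0.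
move=> t h t0 tT h0; rewrite !lt_min => /and3P[hd hb hM].
have {}hM : h * M <= 1 / 2.
  move: hM; rewrite ltr_pdivlMr ?mulr_gt0// => /ltW; lra.
have ht : 0 <= t + h by exact: addr_ge0.
have tth : t <= t + h by rewrite lerDl.
have hth : h <= t + h by rewrite lerDr.
have K2 w : expR (Z 0 t w) <= K.
  by rewrite ler_expR (le_trans (Zt w t0))// ler_pM2l.
have quad : K * (2 * (M * h) ^+ 2) <= e / 2 * h.
  have := ltW hb; rewrite /b ler_pdivlMr; last by rewrite !mulr_gt0// exprn_gt0.
  rewrite -(ler_pM2r (x := 2)) ?ltr0n// => /(ler_wpM2r h0).
  move=> H; rewrite -(ler_pM2r (x := 4))//; nra.
have D1 : \int[Pmu]_w `|Z t (t + h) w - h * U (X t w)| <= a * h by exact: dH.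
have D0 : \int[Pmu]_w `|Z 0 h w - h * U (X 0 w)| <= a * h.
  by have := dH 0 h (lexx 0) h0 hd; rewrite add0r.
have aK : K * (a * h) = e / 4 * h by rewrite /a; field; rewrite gt_eqF.
have b1 := bZ tth; have b2 := bZ h0; have b3 := bX t0; have b4 := bX (lexx 0).
have b5 := bZ t0; have b6 := bZ ht; have b7 := bZ hth.
have K0' := ltW K0.
split.
- apply: (@le_trans _ _ (\int[Pmu]_w (K * (2 * (M * h) ^+ 2) + K * `|Z t (t + h) w - h * U (X t w)|))).
    apply: bRintegral_le => //; [bm|bm|] => w.
    rewrite (ZS w t0 tth) -mulrDr; apply: expR_first_order => //.
    by rewrite ger0_norm// Zh.
  rewrite (bRintegralD Pmu1); [|bm|bm].
  rewrite (bRintegral_cst Pmu1) (bRintegralZl Pmu1); last bm.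
  apply: (le_trans (lerD quad (ler_wpM2l K0' D1))).
  rewrite aK; have : 0 <= e * h by rewrite mulr_ge0// ltW. lra.
- apply: (@le_trans _ _ (\int[Pmu]_w (K * (2 * (M * h) ^+ 2) +
     (K * `|Z t (t + h) w - h * U (X t w)| + K * `|Z 0 h w - h * U (X 0 w)|)))).
    apply: bRintegral_le => //; [bm|bm|] => w.
    rewrite Zshift// -!mulrDr; apply: (le_trans (expR_first_order (K := K) _ h0 K0' hM _ _)) => //.
      exact: Zdiff.
    rewrite ler_pM2l// lerD2l (le_trans _ (ler_normB _ _))// le_eqVlt.
    by apply/predU1P; left; congr (`|_|); ring.
  rewrite (bRintegralD Pmu1); [|bm|bm].
  rewrite (bRintegralD Pmu1); [|bm|bm].
  rewrite (bRintegral_cst Pmu1) !(bRintegralZl Pmu1); [|bm|bm].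
  apply: (le_trans (lerD quad (lerD (ler_wpM2l K0' D1) (ler_wpM2l K0' D0)))).
  rewrite aK; lra.
Qed.

(** The value of L on the Feynman-Kac function at time t: the derivative of the
    exponential functional when its window slides. *)
Definition fk_gen t x : R :=
  \int[P x]_w (expR (Z 0 t w) * (U (X t w) - U (X 0 w))).

Lemma bmeas_fk_gen t : 0 <= t -> bmeas (fk_gen t).
Proof.
move=> t0; apply: bmeas_kernel.
by have := bX t0; have := bX (lexx 0); have := bZ t0; bm.
Qed.

(** The evolution equation d/dt u = L u + U u, whose left-hand side is the
    expectation below; the potential factors out because X_0 = x. *)
Lemma fk_genE t x : 0 <= t ->
  \int[P x]_w (expR (Z 0 t w) * U (X t w)) = fk_gen t x + U x * u t x.
Proof.
move=> t0; have b1 := bX t0; have b2 := bX (lexx 0); have b3 := bZ t0.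
rewrite /fk_gen; under [in RHS]eq_Rintegral do rewrite mulrBr.
rewrite (bRintegralB (kernel1 P x)); [|bm|bm].
rewrite (Rintegral_start HX x (h := fun w => expR (Z 0 t w)) _ bU); last bm.
by rewrite /fk [U x * _]mulrC subrK.
Qed.

(** The difference quotient minus its limit splits into g / h + q.  Here g is null
    by semigroup_fk, and q is small in L1(mu) by first_order_L1; as q is bounded
    uniformly in h it is also small in L2(mu). *)
Lemma fk_generator t : 0 <= t -> L2_generator X P mu (u t) (fk_gen t).
Proof.
move=> t0; have b1 := bu t0; have b2 := bmeas_fk_gen t0.
apply/(L2_generatorP HX) => // e e0.
pose K := expR (M * (t + 1)).
have K0 : 0 < K by exact: expR_gt0.
pose C := 2 * K * M.
have C0 : 0 < C by rewrite !mulr_gt0.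
have e1 : 0 < e / (2 * C) by rewrite divr_gt0// mulr_gt0.
have [d d0 dH] := first_order_L1 t e1.
exists (Num.min d 1); first by rewrite lt_min d0 ltr01.
move=> h hp; rewrite lt_min => /andP[hd h1]; have h0 := ltW hp.
have ht : 0 <= t + h by exact: addr_ge0.
have hth : h <= t + h by rewrite lerDr.
have [_ H] := dH t h t0 (lexx t) h0 hd.
pose V x := \int[P x]_w expR (Z h (t + h) w).
have bZh := bZ hth; have bZt := bZ t0.
have bXt := bX t0; have bX0 := bX (lexx 0).
have bV : bmeas V by apply: bmeas_kernel; bm.
have b3 := bmeas_semigroup HX h0 b1.
have ZhK w : Z h (t + h) w <= M * (t + 1).
  by rewrite addrC (le_trans (Zh h w t0))// ler_pM2l// lerDl.
have ZtK w : Z 0 t w <= M * (t + 1).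
  by rewrite (le_trans (Zt w t0))// ler_pM2l// lerDl.
have V0 x : 0 <= V x <= K.
  rewrite Rintegral_ge0/=; last by move=> w _; exact: expR_ge0.
  rewrite -(bRintegral_cst (kernel1 P x) K).
  by apply: (bRintegral_le (kernel1 P x)); [bm|bm|] => w; rewrite ler_expR.
have pt0 x : 0 <= pt h (u t) x <= K.
  rewrite Rintegral_ge0/=; last first.
    by move=> w _; rewrite (le_trans _ (fk_ge1 _ t0)).
  rewrite -(bRintegral_cst (kernel1 P x) K).
  apply: (bRintegral_le (kernel1 P x)); [exact: (bmeas_path HX)|bm|] => w.
  by rewrite (le_trans (fk_le _ t0))// ler_expR ler_pM2l// lerDl.
(* V is u_t with its window slid by h, and replaces P_h u_t up to a null set *)
pose q x := (V x - u t x) / h - fk_gen t x.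
have bq : bmeas q by rewrite /q; bm.
have qE x : q x = h^-1 * \int[P x]_w (expR (Z h (t + h) w) - expR (Z 0 t w) -
      h * (expR (Z 0 t w) * (U (X t w) - U (X 0 w)))).
  rewrite (bRintegralB (kernel1 P x)); [|bm|bm].
  rewrite (bRintegralB (kernel1 P x)); [|bm|bm].
  rewrite (bRintegralZl (kernel1 P x)); last bm.
  by rewrite mulrBr mulrA mulVf ?gt_eqF// mul1r mulrC.
have qC x : `|q x| <= C.
  rewrite qE normrM ger0_norm ?invr_ge0// mulrC ler_pdivrMr//.
  apply: (@le_trans _ _ (\int[P x]_w (C * h))); last first.
    by rewrite (bRintegral_cst (kernel1 P x)).
  apply: (le_trans (bRintegral_norm (kernel1 P x) _)); first bm.
  apply: (bRintegral_le (kernel1 P x)); [bm|bm|] => w.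
  have -> : C * h = K * (M * h) + h * (K * M) by rewrite /C; ring.
  apply: (le_trans (ler_normB _ _)); apply: lerD.
    apply: (le_trans (expR_dist (ZhK w) (ZtK w))); rewrite ler_pM2l//.
    by rewrite Zshift// addrAC subrr add0r Zdiff.
  rewrite !normrM (ger0_norm h0) ler_wpM2l// ler_pM//.
    by rewrite ger0_norm ?expR_ge0// ler_expR.
  rewrite ler_norml; have := U0M (X t w); have := U0M (X 0 w); lra.
have q1 : \int[mu]_x `|q x| <= e / (2 * C).
  have : \int[mu]_x (h * `|q x|) <= e / (2 * C) * h.
    apply: le_trans H; rewrite Rintegral_path_law; last bm.
    have b4 : bmeas (fun x => \int[P x]_w `|expR (Z h (t + h) w) - expR (Z 0 t w) -
      h * (expR (Z 0 t w) * (U (X t w) - U (X 0 w)))|) by apply: bmeas_kernel; bm.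
    apply: bRintegral_le => //; [bm|] => x.
    rewrite qE normrM mulrA ger0_norm ?invr_ge0// mulfV ?gt_eqF// mul1r.
    by apply: (bRintegral_norm (kernel1 P x)); bm.
  by rewrite (bRintegralZl mu1) 1?mulrC ?ler_pM2r//; bm.
pose g x := pt h (u t) x - V x.
have bg : bmeas g by rewrite /g; bm.
have g0 : \int[mu]_x `|g x| = 0.
  by have := semigroup_fk HX mu_inv P_cont mU U0M h0 t0; rewrite [h + t]addrC.
apply: (@le_trans _ _ (\int[mu]_x (2 * K * h^-1 ^+ 2 * `|g x| + 2 * C * `|q x|))).
  apply: bRintegral_le => //; [bm|bm|] => x.
  have -> : (pt h (u t) x - u t x) / h - fk_gen t x = g x / h + q x.
    by rewrite /g /q; ring.
  apply: (@le_trans _ _ (2 * (g x / h) ^+ 2 + 2 * (q x) ^+ 2)).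
    by rewrite -subr_ge0 (_ : _ - _ = (g x / h - q x) ^+ 2) ?sqr_ge0//; ring.
  apply: lerD.
    have gK : `|g x| <= K.
      rewrite ler_norml; have := V0 x; have := pt0 x; rewrite /g; lra.
    rewrite exprMn -[g x ^+ 2]real_normK ?num_real// mulrCA.
    rewrite [leRHS](_ : _ = h^-1 ^+ 2 * (2 * (K * `|g x|)))//; last ring.
    rewrite [leLHS](_ : _ = h^-1 ^+ 2 * (2 * (`|g x| * `|g x|)))//; last ring.
    by rewrite ler_wpM2l ?sqr_ge0// ler_pM2l// ler_wpM2r.
  rewrite -[q x ^+ 2]real_normK ?num_real// expr2 -mulrA ler_pM2l//.
  by rewrite ler_wpM2r.
rewrite (bRintegralD mu1); [|bm|bm].
rewrite !(bRintegralZl mu1); [|bm|bm].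
rewrite g0 mulr0 add0r (le_trans (ler_wpM2l _ q1))//; first by rewrite mulr_ge0// ltW.
by rewrite mulrC divfK// gt_eqF// mulr_gt0.
Qed.

(** An upper bound for the quadratic form of the generator plus U, tested on the
    bounded part of the domain, where the Feynman-Kac functions lie. *)
Variable L : R.
Hypothesis L0 : 0 <= L.
Hypothesis dissipative : forall g Lg, bmeas g -> bmeas Lg -> L2_generator X P mu g Lg ->
  \int[mu]_x (U x * g x ^+ 2 + Lg x * g x) <= L * \int[mu]_x (g x ^+ 2).

Local Notation phi t := (\int[mu]_x (u t x ^+ 2)).

(** Over a time step h the squared norm grows by 2 h times the quadratic form of
    L + U at u_t, up to an error that is o(h) uniformly in t. *)
Lemma fk_growth_step (T e : R) : 0 < e -> exists2 d : R, 0 < d &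
  forall t h : R, 0 <= t -> t <= T -> 0 <= h -> h < d ->
    phi (t + h) <= expR (2 * L * h) * phi t + e * h.
Proof.
move=> e0; pose K := expR (M * (T + 1)).
have K0 : 0 < K by exact: expR_gt0.
have e1 : 0 < e / (4 * K) by rewrite divr_gt0// mulr_gt0.
have [d d0 dH] := first_order_L1 T e1.
pose b := e / (2 * (K * M) ^+ 2).
have b0 : 0 < b by rewrite divr_gt0// !mulr_gt0// exprn_gt0// mulr_gt0.
exists (Num.min d (Num.min b 1)); first by rewrite !lt_min d0 b0 ltr01.
move=> t h t0 tT h0; rewrite !lt_min => /and3P[hd hb h1].
have ht : 0 <= t + h by exact: addr_ge0.
have tth : t <= t + h by rewrite lerDl.
have [H _] := dH t h t0 tT h0 hd.
have b1 := bu t0; have b2 := bu ht; have b3 := bmeas_fk_gen t0.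
have bZt := bZ t0; have bZh := bZ ht; have bXt := bX t0.
pose W x := \int[P x]_w (expR (Z 0 t w) * U (X t w)).
have bW : bmeas W by apply: bmeas_kernel; bm.
have uK x : u t x <= K.
  by rewrite (le_trans (fk_le x t0))// ler_expR ler_pM2l//; lra.
have ud x : `|u (t + h) x - u t x| <= K * M * h.
  rewrite -(bRintegralB (kernel1 P x)); [|bm|bm].
  rewrite -[leRHS](bRintegral_cst (kernel1 P x)).
  apply: (le_trans (bRintegral_norm (kernel1 P x) _)); first bm.
  apply: (bRintegral_le (kernel1 P x)); [bm|bm|] => w.
  have TK s : 0 <= s -> s <= T + 1 -> Z 0 s w <= M * (T + 1).
    by move=> s0 sT; rewrite (le_trans (Zt w s0))// ler_pM2l.
  apply: (le_trans (expR_dist (TK _ ht _) (TK _ t0 _))); [lra|lra|].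
  rewrite -mulrA ler_pM2l// (ZS w t0 tth) addrAC subrr add0r ger0_norm//.
  exact: Zh.
have rE x : u (t + h) x - u t x - h * W x = \int[P x]_w (expR (Z 0 (t + h) w) -
    expR (Z 0 t w) - h * (expR (Z 0 t w) * U (X t w))).
  rewrite (bRintegralB (kernel1 P x)); [|bm|bm].
  rewrite (bRintegralB (kernel1 P x)); [|bm|bm].
  by rewrite (bRintegralZl (kernel1 P x))//; bm.
have r1 : \int[mu]_x `|u (t + h) x - u t x - h * W x| <= e / (4 * K) * h.
  apply: le_trans H; rewrite Rintegral_path_law; last bm.
  have b4 : bmeas (fun x => \int[P x]_w `|expR (Z 0 (t + h) w) - expR (Z 0 t w) -
    h * (expR (Z 0 t w) * U (X t w))|) by apply: bmeas_kernel; bm.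
  apply: bRintegral_le => //; [bm|] => x.
  by rewrite rE; apply: (bRintegral_norm (kernel1 P x)); bm.
have D : \int[mu]_x (W x * u t x) <= L * phi t.
  apply: le_trans (dissipative b1 b3 (fk_generator t0)).
  rewrite le_eqVlt; apply/predU1P; left; apply: eq_Rintegral => x _.
  by rewrite /W fk_genE//; ring.
apply: (@le_trans _ _ (\int[mu]_x (u t x ^+ 2 + (2 * h * (W x * u t x) +
   (2 * K * `|u (t + h) x - u t x - h * W x| + (K * M * h) ^+ 2))))).
  apply: bRintegral_le => //; [bm|bm|] => x.
  apply: (@square_increment_le R h K (K * M * h) (u (t + h) x) (u t x) (W x)) => //.
  by rewrite uK (le_trans ler01)// fk_ge1.
rewrite (bRintegralD mu1); [|bm|bm].
rewrite (bRintegralD mu1); [|bm|bm].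
rewrite (bRintegralD mu1); [|bm|bm].
rewrite (bRintegral_cst mu1) !(bRintegralZl mu1); [|bm|bm].
have E1 : 2 * h * \int[mu]_x (W x * u t x) <= 2 * h * (L * phi t).
  by rewrite ler_wpM2l// mulr_ge0.
have E2 : 2 * K * \int[mu]_x `|u (t + h) x - u t x - h * W x| <= e / 2 * h.
  rewrite (_ : e / 2 * h = 2 * K * (e / (4 * K) * h)).
    by rewrite ler_wpM2l// mulr_ge0// ltW.
  by field; rewrite gt_eqF.
have E3 : (K * M * h) ^+ 2 <= e / 2 * h.
  move: (ltW hb); rewrite /b ler_pdivlMr; last by rewrite mulr_gt0// exprn_gt0// mulr_gt0.
  rewrite -(ler_pM2r (x := 2)) ?ltr0n// => /(ler_wpM2r h0); rewrite exprMn; nra.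
have E4 : (1 + 2 * L * h) * phi t <= expR (2 * L * h) * phi t.
  rewrite ler_wpM2r//; last exact: expR_ge1Dx.
  by apply: Rintegral_ge0 => x _; exact: sqr_ge0.
apply: (le_trans (lerD (lexx _) (lerD E1 (lerD E2 E3)))).
by move: E4; move: (phi t) (expR _) => p q; lra.
Qed.

(** Gronwall's inequality, by iterating fk_growth_step on a fine grid. *)
Lemma fk_growth T : 0 <= T -> phi T <= expR (2 * L * T).
Proof.
move=> T0; apply/ler_addgt0Pr => e e0.
pose K := expR (2 * L * T) * (T + 1).
have K0 : 0 < K by rewrite mulr_gt0 ?expR_gt0//; lra.
have [d d0 dH] := fk_growth_step T (divr_gt0 e0 K0).
pose n := (Num.truncn (T / d)).+1.
have Tn : T / d < n%:R by exact: truncnS_gt.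
have n0 : 0 < n%:R :> R by rewrite ltr0n.
pose h := T / n%:R.
have h0 : 0 <= h by rewrite divr_ge0.
have nh : n%:R * h = T by rewrite mulrC divfK// gt_eqF.
have hd : h < d by rewrite ltr_pdivrMr// mulrC -ltr_pdivrMr.
have H k : (k <= n)%N -> phi (k%:R * h) <=
    expR (2 * L * (k%:R * h)) * (1 + e / K * (k%:R * h)).
  elim: k => [_|k ih kn].
    rewrite mul0r !mulr0 expR0 addr0 mul1r.
    under eq_Rintegral do rewrite fk0 expr1n.
    by rewrite (bRintegral_cst mu1).
  have kh0 : 0 <= k%:R * h by rewrite mulr_ge0.
  have khT : k%:R * h <= T by rewrite -nh ler_wpM2r// ler_nat ltnW.
  have kE : k.+1%:R * h = k%:R * h + h by rewrite -natr1; ring.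
  rewrite kE (le_trans (dH _ _ kh0 khT h0 hd))//.
  have := ih (ltnW kn); rewrite -(ler_pM2l (expR_gt0 (2 * L * h))) => ih'.
  rewrite (le_trans (lerD ih' (lexx _)))//.
  rewrite mulrA -expRD -mulrDr [h + _]addrC.
  have -> : e / K * (k%:R * h + h) = e / K * (k%:R * h) + e / K * h by ring.
  rewrite addrA (mulrDr _ _ (e / K * h)) lerD2l.
  rewrite ler_peMl//; first by rewrite mulr_ge0// divr_ge0// ltW.
  by rewrite -expR0 ler_expR mulr_ge0 ?addr_ge0// mulr_ge0.
have := H n (leqnn n); rewrite nh => /le_trans; apply.
rewrite mulrDr mulr1 lerD2l.
have T1 : T + 1 != 0 by rewrite gt_eqF// ltr_wpDl.
have eN : expR (2 * L * T) != 0 by rewrite gt_eqF// expR_gt0.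
have -> : expR (2 * L * T) * (e / K * T) = e * (T / (T + 1)).
  by rewrite /K; field; rewrite ?T1 ?eN.
rewrite ler_piMr ?ltW// ltr_pdivrMr ?mul1r; lra.
Qed.

End feynman_kac_generator.

(** * Young functions and the gauge norm *)

Section young_functions.
Context (R : realType) (G : R -> R).
Hypothesis HG : normalised_young G.

Lemma young_ge0 x : 0 <= x -> 0 <= G x.
Proof.
by move=> x0; have [_ + G0 _] := HG; rewrite -{2}G0; apply; rewrite ?in_itv/= ?lexx ?x0.
Qed.

Lemma young_inequality x y : 0 <= x -> ((x * y)%:E <= (G x)%:E + fenchel_legendre G y)%E.
Proof.
move=> x0; have : ((x * y - G x)%:E <= fenchel_legendre G y)%E.
  by apply: ereal_sup_ubound; exists x => //=; rewrite in_itv/= x0.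
by rewrite EFinB leeBlDl.
Qed.

Lemma fenchel_legendre_ge0 y : (0 <= fenchel_legendre G y)%E.
Proof.
have [_ _ G0 _] := HG.
by have := young_inequality y (lexx 0); rewrite mul0r G0 add0e.
Qed.

Lemma fenchel_legendre1 : fenchel_legendre G 1 = (1 - G 1)%:E.
Proof.
have [_ _ _] := HG; have := fenchel_legendre_ge0 1.
case: fenchel_legendre => [r| |]// _.
by rewrite -EFinD => -[H]; congr (_%:E); lra.
Qed.

(** The normalisation says that 1 attains the supremum which defines the conjugate
    at 1, so the line of slope 1 through (1, G(1)) supports G. *)
Lemma young_ge_affine x : 0 <= x -> x + G 1 <= G x + 1.
Proof.
move=> x0; have := young_inequality 1 x0.
by rewrite fenchel_legendre1 mulr1 -EFinD lee_fin; lra.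
Qed.

(** Convexity between x and 0. *)
Lemma young_scale x K : 0 <= x -> 1 <= K -> G (x / K) <= G x / K.
Proof.
move=> x0 K1; have K0 : 0 < K by exact: lt_le_trans K1.
have [cG _ G0 _] := HG.
have t01 : 0 <= K^-1 <= 1 by rewrite invr_ge0 ltW//= invf_le1.
have := cG (Itv01 (proj1 (andP t01)) (proj2 (andP t01))) x 0.
rewrite !inE/= !in_itv/= x0 lexx => /(_ isT isT).
rewrite convRE/= G0 mulr0 addr0 [X in G X](_ : _ = K^-1 * x); last first.
  rewrite /conv/= /convex.isConvexSpace.conv /=.
  by rewrite scaler0 addr0.
by rewrite ![K^-1 * _]mulrC.
Qed.

Lemma measurable_young d (T : measurableType d) (f : T -> R) :
  measurable_fun setT f -> (forall x, 0 <= f x) -> measurable_fun setT (G \o f).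
Proof.
move=> mf f0; have [_ ndG _ _] := HG.
have mG : measurable_fun setT (fun y : R => G (Num.max 0 y)).
  apply: nondecreasing_measurable => // x y xy.
  have m0 (z : R) : Num.max 0 z \in `[0, +oo[ by rewrite in_itv/= andbT; rewrite le_max lexx.
  by apply: ndG => //; rewrite ge_max !le_max lexx xy orbT.
have := measurableT_comp mG mf.
by congr measurable_fun; apply/funext => x /=; rewrite max_r.
Qed.

Lemma fenchel_legendre_homo x y : x <= y ->
  (fenchel_legendre G x <= fenchel_legendre G y)%E.
Proof.
move=> xy; apply: ge_ereal_sup => b [z /=]; rewrite in_itv/= andbT => z0 <-{b}.
apply: (@le_trans _ _ (z * y - G z)%:E).
  by rewrite lee_fin lerD2r ler_wpM2l.
by apply: ereal_sup_ubound; exists z => //=; rewrite in_itv/= z0.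
Qed.

(** The conjugate is monotone, so its sublevel sets are intervals. *)
Lemma measurable_fenchel_legendre : measurable_fun setT (fenchel_legendre G).
Proof.
apply: (measurability _ (ErealGenInftyO.measurableE R)) => _ /= -[_ [r ->] <-].
rewrite setTI preimage_itvNyo; apply: is_interval_measurable => a b /= ra rb c.
move=> /andP[_ cb]; exact: le_lt_trans (fenchel_legendre_homo cb) rb.
Qed.

(* Hoelder inequality between G and its conjugate, for a density k *)
(** Integrating the supporting line of G at 1 gives G(1) <= I.  Hence k / K with
    K = I / G(1) >= 1 satisfies int G(k / K) <= G(1), and Young's inequality
    integrates to G(1) + G^*(1) = 1. *)
Lemma gauge_holder d (T : measurableType d) (mu : probability T R) (V k : T -> R) (v I : R) :
  measurable_fun setT V -> measurable_fun setT k -> (forall x, 0 <= k x) ->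
  (\int[mu]_x (k x)%:E = 1)%E -> (\int[mu]_x (G (k x))%:E <= I%:E)%E ->
  0 < G 1 -> 0 < v ->
  (\int[mu]_x fenchel_legendre G (`|V x| / v) <= fenchel_legendre G 1)%E ->
  G 1 <= I /\ (\int[mu]_x (`|V x| * k x)%:E <= (v * I / G 1)%:E)%E.
Proof.
move=> mV mk k0 k1 kI G1 v0 Vv.
have mGk : measurable_fun setT (fun x => (G (k x))%:E).
  by apply/measurable_EFinP; exact: measurable_young.
have Gk0 x : (0 <= (G (k x))%:E)%E by rewrite lee_fin young_ge0.
have mk' : measurable_fun setT (fun x => (k x)%:E) by exact/measurable_EFinP.
have G1I : G 1 <= I.
  have : (\int[mu]_x ((k x)%:E + (G 1)%:E) <= \int[mu]_x ((G (k x))%:E + 1))%E.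
    apply: ge0_le_integral => //.
    - by move=> x _; rewrite lee_fin addr_ge0// ltW.
    - exact: emeasurable_funD.
    - exact: emeasurable_funD.
    - by move=> x _; rewrite -!EFinD lee_fin young_ge_affine.
  rewrite !ge0_integralD//; try by move=> x _; rewrite lee_fin// ltW.
  rewrite k1 !integral_cst// [X in (_ + _ * X <= _ + _ * X)%E]probability_setT !mule1.
  rewrite addeC leeD2rE// => /le_trans/(_ kI); by rewrite lee_fin.
split=> //; pose K := I / G 1.
have K1 : 1 <= K by rewrite ler_pdivlMr// mul1r.
have K0 : 0 < K by exact: lt_le_trans K1.
have mVv : measurable_fun setT (fun x => `|V x| / v).
  by apply: measurable_funM => //; exact: measurableT_comp.
have mFL : measurable_fun setT (fun x => fenchel_legendre G (`|V x| / v)).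
  exact: (measurableT_comp measurable_fenchel_legendre mVv).
have mprod : measurable_fun setT (fun x => (`|V x| / v * (k x / K))%:E).
  by apply/measurable_EFinP; do 2 apply: measurable_funM => //.
have prod0 x : 0 <= `|V x| / v * (k x / K).
  by rewrite mulr_ge0// divr_ge0// ltW.
have -> : (v * I / G 1)%R = (v * K)%R by rewrite /K mulrA.
have vK : 0 < v * K by rewrite mulr_gt0.
under eq_integral.
  move=> x _.
  have -> : `|V x| * k x = (v * K) * (`|V x| / v * (k x / K)).
    by field; rewrite !gt_eqF.
  rewrite EFinM; over.
rewrite ge0_integralZl//; [|by move=> x _; rewrite lee_fin; exact: prod0|by rewrite lee_fin ltW].
rewrite -[leRHS]mule1; apply: lee_wpmul2l; first by rewrite lee_fin ltW.
apply: (@le_trans _ _ (\int[mu]_x ((K^-1)%:E * (G (k x))%:E +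
    fenchel_legendre G (`|V x| / v))%E)%E).
  apply: ge0_le_integral => //.
  - by move=> x _; rewrite lee_fin; exact: prod0.
  - by apply: emeasurable_funD => //; exact: measurable_funeM.
  - move=> x _; have kK : 0 <= k x / K by rewrite divr_ge0// ltW.
    rewrite mulrC (le_trans (young_inequality _ kK))// leeD2r//.
    by rewrite -EFinM lee_fin [leRHS]mulrC young_scale.
rewrite ge0_integralD//; last 3 first.
- by move=> x _; rewrite mule_ge0// lee_fin invr_ge0 ltW.
- exact: measurable_funeM.
- by move=> x _; exact: fenchel_legendre_ge0.
rewrite ge0_integralZl//; last by rewrite lee_fin invr_ge0 ltW.
rewrite fenchel_legendre1 in Vv.
apply: (le_trans (leeD (lee_wpmul2l _ kI) Vv)); first by rewrite lee_fin invr_ge0 ltW.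
rewrite -EFinM -EFinD lee_fin.
have -> : K^-1 * I = G 1 by rewrite /K; field; rewrite !gt_eqF//; exact: lt_le_trans G1I.
lra.
Qed.

End young_functions.

(** * The quadratic form estimate *)

Lemma energy_balance (R : realType) (e b c q w x k n : R) :
  b <= e / 2 -> c <= n + b -> q <= e / 2 -> w <= k -> 0 <= x ->
  w + c + q - e <= k + n + x.
Proof. lra. Qed.

Section dissipativity.
Context (R : realType) (dE dO : measure_display).
Context (E : measurableType dE) (Omega : measurableType dO).
Variables (X : R -> Omega -> E) (P : R.-pker E ~> Omega).
Hypothesis HX : markov_process X P.
Variable mu : probability E R.
Hypothesis mu_inv : invariant_measure X P mu.

Local Notation pt := (transition_semigroup X P).
Let mu1 : mu setT = 1%E := probability_setT mu.

(** By invariance the difference quotients have mean 0. *)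
Lemma generator_mean (g Lg : E -> R) : bmeas g -> bmeas Lg ->
  L2_generator X P mu g Lg -> \int[mu]_x Lg x = 0.
Proof.
move=> bg bL /(L2_generatorP HX mu bg bL) H.
apply/eqP; rewrite -normr_eq0 eq_le normr_ge0 andbT.
apply/ler_addgt0Pr => e e0; rewrite add0r.
have [d d0 dH] := H _ (exprn_gt0 2 e0).
have d2 : 0 < d / 2 by rewrite divr_gt0.
have := dH _ d2 _; rewrite ltr_pdivrMr// mulr2n mulrDr mulr1 ltrDl => /(_ d0).
set t := d / 2 => {}dH.
have bp := bmeas_semigroup HX (ltW d2) bg.
have bF := bmeas_diff_quotient HX d2 bg bL.
have -> : \int[mu]_x Lg x = - \int[mu]_x ((pt t g x - g x) / t - Lg x).
  rewrite (bRintegralB mu1); [|bm|bm].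
  rewrite (bRintegralZr mu1); last bm.
  rewrite (bRintegralB mu1); [|bm|bm].
  by rewrite (invariant_semigroup HX mu_inv (ltW d2) bg) subrr mul0r sub0r opprK.
rewrite normrN (le_trans (bRintegral_norm mu1 bF))//.
rewrite (le_trans (Rintegral_norm_le_sqr mu1 bF e0))//.
rewrite ler_pdivrMr// mulr2n mulrDr mulr1 lerD2l ler_pdivrMr// -expr2.
Qed.

Lemma semigroup_affine (g : E -> R) (a c t : R) x : 0 <= t -> bmeas g ->
  pt t (fun y => (g y - a) * c) x = (pt t g x - a) * c.
Proof.
move=> t0 bg; have b := bmeas_path HX t0 bg.
rewrite /transition_semigroup (bRintegralZr (kernel1 P x)); last bm.
rewrite (bRintegralB (kernel1 P x)); [|bm|bm].
by rewrite (bRintegral_cst (kernel1 P x)).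
Qed.

Lemma generator_affine (g Lg : E -> R) (a c : R) : bmeas g -> bmeas Lg ->
  L2_generator X P mu g Lg ->
  L2_generator X P mu (fun x => (g x - a) * c) (fun x => Lg x * c).
Proof.
move=> bg bL /(L2_generatorP HX mu bg bL) H; apply/(L2_generatorP HX); [bm|bm|] => e e0.
have c0 : 0 < c ^+ 2 + 1 by rewrite ltr_wpDl// sqr_ge0.
have [d d0 dH] := H _ (divr_gt0 e0 c0).
exists d => // t t0 td; have := dH t t0 td.
have bF := bmeas_diff_quotient HX t0 bg bL.
have b2 := bmeasX 2 bF.
rewrite ler_pdivlMr// => {}dH.
under eq_Rintegral.
  move=> x _; rewrite semigroup_affine ?ltW//.
  have -> : ((pt t g x - a) * c - (g x - a) * c) / t - Lg x * c =
    ((pt t g x - g x) / t - Lg x) * c by ring.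
  rewrite exprMn; over.
rewrite (bRintegralZr mu1 _ b2); apply: le_trans dH; apply: ler_wpM2l.
  by apply: Rintegral_ge0 => x _; exact: sqr_ge0.
by rewrite lerDl.
Qed.

Variables (F : R -> R) (C : R).
Hypothesis HF : contractive_function F.
Hypothesis C0 : 0 < C.
Hypothesis HSF : strong_F_sobolev X P mu F C.

Local Notation G := (young_of F).
Let HG : normalised_young G := proj2 HF.
Hypothesis G1 : 0 < G 1.

Variables (V : E -> R) (m : R).
Hypothesis mV : measurable_fun setT V.
Hypothesis V_var : (\int[mu]_x (V x ^+ 2)%:E = (m ^+ 2)%:E)%E.

(** The constants over which the gauge norm is the infimum. *)
Definition gauge_admissible (v : R) := 0 < v /\
  (\int[mu]_x fenchel_legendre G (`|V x| / v) <= fenchel_legendre G 1)%E.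

Variable W : E -> R.
Hypothesis bW : bmeas W.
Hypothesis WV : forall x, `|W x| <= `|V x|.

Lemma Rintegral_sqr_le_var : \int[mu]_x (W x ^+ 2) <= m ^+ 2.
Proof.
rewrite -lee_fin -V_var (EFin_Rintegral mu1); last bm.
apply: ge0_le_integral => //.
- by move=> x _; rewrite lee_fin sqr_ge0.
- by apply/measurable_EFinP/bmeas_meas; bm.
- by apply/measurable_EFinP; exact: measurable_funX.
- move=> x _; rewrite lee_fin -[W x ^+ 2]real_normK ?num_real//.
  by rewrite -[V x ^+ 2]real_normK ?num_real// lerXn2r ?nnegrE.
Qed.

Section domain.
Variables g Lg : E -> R.
Hypotheses (bg : bmeas g) (bL : bmeas Lg) (Hg : L2_generator X P mu g Lg).

Local Notation a := (\int[mu]_x g x).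
Local Notation h := (fun x => g x - a).
Local Notation s2 := (\int[mu]_x ((g x - a) ^+ 2)).
Local Notation En := (- \int[mu]_x (Lg x * g x)).

Let bh : bmeas h. Proof. by bm. Qed.

Lemma energy_centered : \int[mu]_x (Lg x * (g x - a)) = - En.
Proof.
under eq_Rintegral do rewrite mulrBr.
rewrite (bRintegralB mu1); [|bm|bm].
by rewrite (bRintegralZr mu1) ?(generator_mean bg bL Hg) ?mul0r ?subr0 ?opprK//; bm.
Qed.

Lemma mean_centered : \int[mu]_x (g x - a) = 0.
Proof. by rewrite (bRintegralB mu1) ?(bRintegral_cst mu1) ?subrr//; bm. Qed.

Lemma variance_decomposition : \int[mu]_x (g x ^+ 2) = a ^+ 2 + s2.
Proof.
have -> : \int[mu]_x (g x ^+ 2) =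
    \int[mu]_x ((g x - a) ^+ 2 + (2 * a * (g x - a) + a ^+ 2)).
  by apply: eq_Rintegral => x _; ring.
rewrite (bRintegralD mu1); [|bm|bm].
rewrite (bRintegralD mu1); [|bm|bm].
rewrite (bRintegralZl mu1); last bm.
by rewrite mean_centered mulr0 add0r (bRintegral_cst mu1) addrC.
Qed.

(** If g has variance 0 it is almost everywhere its mean; this case cannot be
    normalised and is treated apart. *)
Lemma degenerate_integral (f : E -> R) : bmeas f -> s2 = 0 ->
  \int[mu]_x (f x * (g x - a)) = 0.
Proof.
move=> bf s0; have [K K1 fK] := bmeas_bound bf.
have K0 : 0 < K by exact: lt_le_trans K1.
apply/eqP; rewrite -normr_eq0 eq_le normr_ge0 andbT.
apply/ler_addgt0Pr => e e0; rewrite add0r.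
have bfh : bmeas (fun x => f x * (g x - a)) by bm.
rewrite (le_trans (bRintegral_norm mu1 bfh))//.
apply: (@le_trans _ _ (K * \int[mu]_x `|g x - a|)).
  rewrite -(bRintegralZl mu1); last bm.
  by apply: bRintegral_le => //; [bm|bm|] => x; rewrite normrM ler_wpM2r.
rewrite mulrC -ler_pdivlMr//.
have eK : 0 < e / K by rewrite divr_gt0.
rewrite (le_trans (Rintegral_norm_le_sqr mu1 bh eK))//.
by rewrite s0 mul0r addr0 ler_pdivrMr// ler_peMr ?ler1n// ltW.
Qed.

(** The Sobolev inequality for the normalised centred function, used twice: as a
    Poincare inequality, and as the bound on int G(k) that gauge_holder needs. *)
Lemma sobolev_gauge (v : R) : gauge_admissible v ->
  G 1 * s2 <= C * En /\ \int[mu]_x (`|W x| * (g x - a) ^+ 2) <= v * C * En / G 1.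
Proof.
move=> [v0 Vv].
have s20 : 0 <= s2 by apply: Rintegral_ge0 => x _; exact: sqr_ge0.
have [s0|s0] := eqVneq s2 0.
  have E0 : En = 0 by rewrite -[LHS]opprK -energy_centered degenerate_integral ?oppr0.
  rewrite s0 E0 !mulr0 mul0r; split => //.
  under eq_Rintegral do rewrite expr2 mulrA.
  by rewrite degenerate_integral//; bm.
have {s0}s0 : 0 < s2 by rewrite lt_neqAle eq_sym s0.
pose s := Num.sqrt s2.
have sp : 0 < s by rewrite sqrtr_gt0.
have ss : s ^+ 2 = s2 by rewrite sqr_sqrtr.
pose k x := (g x - a) * s^-1.
have bk : bmeas k by rewrite /k; bm.
have kE x : k x ^+ 2 = (g x - a) ^+ 2 / s2 by rewrite /k exprMn exprVn ss.
have k1 : (\int[mu]_x (k x ^+ 2)%:E = 1)%E.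
  rewrite -(EFin_Rintegral mu1); last bm.
  under eq_Rintegral do rewrite kE.
  by rewrite (bRintegralZr mu1) ?divff ?gt_eqF//; bm.
have k0 : (\int[mu]_x (k x)%:E = 0)%E.
  rewrite -(EFin_Rintegral mu1)// (bRintegralZr mu1)//.
  by rewrite mean_centered mul0r.
have := HSF (generator_affine a s^-1 bg bL Hg) k0 k1.
have -> : \int[mu]_x (Lg x * s^-1 * ((g x - a) * s^-1)) = - En / s2.
  under eq_Rintegral.
    move=> x _; have -> : Lg x * s^-1 * ((g x - a) * s^-1) = (Lg x * (g x - a)) / s2.
      by rewrite -ss; field; rewrite gt_eqF.
    over.
  by rewrite (bRintegralZr mu1) ?energy_centered//; bm.
rewrite (_ : - C * (- En / s2) = C * En / s2); last by rewrite mulNr mulNr mulrN opprK mulrA.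
move=> Gk.
have mk : measurable_fun setT (fun x => k x ^+ 2) by apply: bmeas_meas; bm.
have [GI WI] := gauge_holder HG mV mk (fun x => sqr_ge0 _) k1 Gk G1 v0 Vv.
split; first by move: GI; rewrite ler_pdivlMr.
rewrite (_ : v * C * En / G 1 = s2 * (v * (C * En / s2) / G 1)); last first.
  by field; rewrite !gt_eqF.
rewrite -ler_pdivrMl// -(bRintegralZl mu1); last bm.
rewrite -lee_fin; apply: le_trans WI.
rewrite (EFin_Rintegral mu1); last bm.
apply: ge0_le_integral => //.
- by move=> x _; rewrite lee_fin mulr_ge0 ?invr_ge0// mulr_ge0// sqr_ge0.
- by apply/measurable_EFinP/bmeas_meas; bm.
- by apply/measurable_EFinP; apply: measurable_funM => //; exact: measurableT_comp.
- move=> x _; rewrite lee_fin kE mulrCA [s2^-1 * _]mulrC ler_wpM2r//.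
  by rewrite divr_ge0 ?sqr_ge0.
Qed.

(** The quadratic form is split along g = a + h.  The square term is at most
    En / 2 by sobolev_gauge, the infimum over admissible v being approached
    through eta; the cross term is spread over al W^2 + be h^2, where be is
    chosen so that be h^2 integrates to at most En / 2 by Poincare. *)
Lemma energy_form_le (l kappa : R) : 0 <= l ->
  `|\int[mu]_x W x| <= kappa ->
  (forall eta : R, 0 < eta -> exists2 v, gauge_admissible v & 2 * C * l * v <= G 1 + eta) ->
  l * \int[mu]_x (W x * g x ^+ 2) - En <=
    (l * kappa + 2 * m ^+ 2 * C / G 1 * l ^+ 2) * \int[mu]_x (g x ^+ 2).
Proof.
move=> l0 Wk adm.
have s20 : 0 <= s2 by apply: Rintegral_ge0 => x _; exact: sqr_ge0.
have [v0 /sobolev_gauge[P1 _] _] := adm 1 ltr01.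
have En0 : 0 <= En.
  by rewrite -(pmulr_rge0 _ C0) (le_trans _ P1)// mulr_ge0// ltW.
(* al * be = (l * a) ^ 2, so that 2 l a W h <= al W^2 + be h^2 pointwise *)
pose al := 2 * l ^+ 2 * a ^+ 2 * C / G 1.
pose be := G 1 / (2 * C).
have be_s : be * s2 <= En / 2.
  rewrite /be mulrAC ler_pdivrMr ?mulr_gt0// (le_trans P1)//.
  by rewrite le_eqVlt; apply/predU1P; left; field.
have cross : l * (2 * a * \int[mu]_x (W x * (g x - a))) <= al * m ^+ 2 + be * s2.
  apply: (@le_trans _ _ (al * \int[mu]_x (W x ^+ 2) + be * s2)); last first.
    rewrite lerD2r ler_wpM2l ?Rintegral_sqr_le_var//.
    by rewrite /al divr_ge0 ?(ltW G1)// mulr_ge0 ?(ltW C0)// mulr_ge0 ?sqr_ge0// mulr_ge0 ?sqr_ge0.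
  rewrite mulrA -[leLHS](bRintegralZl mu1 (l * (2 * a))); last bm.
  rewrite -(bRintegralZl mu1 al); last bm.
  rewrite -(bRintegralZl mu1 be); last bm.
  rewrite -(bRintegralD mu1); [|bm|bm].
  apply: bRintegral_le => //; [bm|bm|] => x.
  rewrite -subr_ge0 (_ : _ - _ = (2 * l * a * C * W x - G 1 * (g x - a)) ^+ 2 / (2 * C * G 1)).
    by rewrite divr_ge0 ?sqr_ge0// mulr_ge0 ?(ltW G1)// mulr_ge0 ?(ltW C0).
  by rewrite /al /be; field; rewrite !gt_eqF.
have quad : l * \int[mu]_x (W x * (g x - a) ^+ 2) <= En / 2.
  apply: (@le_trans _ _ (l * \int[mu]_x (`|W x| * (g x - a) ^+ 2))).
    rewrite ler_wpM2l//; apply: bRintegral_le => //; [bm|bm|] => x.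
    by rewrite ler_wpM2r ?sqr_ge0// ler_norm.
  apply/ler_addgt0Pr => e e0.
  have E1 : 0 < En + 1 by rewrite ltr_wpDl.
  (* the + 1 avoids a division by a zero energy *)
  have eta0 : 0 < 2 * e * G 1 / (En + 1) by rewrite divr_gt0// mulr_gt0// mulr_gt0.
  have [v /sobolev_gauge[_ Hv] lv] := adm _ eta0.
  apply: (le_trans (ler_wpM2l l0 Hv)).
  have -> : l * (v * C * En / G 1) = (2 * C * l * v) * (En / (2 * G 1)).
    by field; rewrite gt_eqF.
  apply: (@le_trans _ _ ((G 1 + 2 * e * G 1 / (En + 1)) * (En / (2 * G 1)))).
    by rewrite ler_wpM2r// divr_ge0// mulr_ge0// ltW.
  have -> : (G 1 + 2 * e * G 1 / (En + 1)) * (En / (2 * G 1)) =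
    En / 2 + e * (En / (En + 1)) by field; rewrite !gt_eqF.
  by rewrite lerD2l ler_piMr ?ltW// ltr_pdivrMr// mul1r ltrDl.
have decomp : l * \int[mu]_x (W x * g x ^+ 2) =
    l * (a ^+ 2 * \int[mu]_x W x) + l * (2 * a * \int[mu]_x (W x * (g x - a))) +
    l * \int[mu]_x (W x * (g x - a) ^+ 2).
  rewrite -!mulrDr; congr (l * _).
  rewrite -(bRintegralZl mu1 (a ^+ 2)) -?(bRintegralZl mu1 (2 * a)); [|bm|bm].
  rewrite -(bRintegralD mu1); [|bm|bm].
  rewrite -(bRintegralD mu1); [|bm|bm].
  by apply: eq_Rintegral => x _; ring.
have meanW : l * (a ^+ 2 * \int[mu]_x W x) <= l * kappa * a ^+ 2.
  rewrite -mulrA ler_wpM2l// mulrC ler_wpM2r ?sqr_ge0//.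
  exact: le_trans (ler_norm _) Wk.
have kappa0 : 0 <= kappa by exact: le_trans Wk.
have -> : (l * kappa + 2 * m ^+ 2 * C / G 1 * l ^+ 2) * \int[mu]_x (g x ^+ 2) =
    (l * kappa * a ^+ 2 + al * m ^+ 2) + (l * kappa + 2 * m ^+ 2 * C / G 1 * l ^+ 2) * s2.
  by rewrite variance_decomposition /al; ring.
have pos : 0 <= (l * kappa + 2 * m ^+ 2 * C / G 1 * l ^+ 2) * s2.
  apply: mulr_ge0 => //; apply: addr_ge0; first exact: mulr_ge0.
  rewrite mulr_ge0 ?sqr_ge0// divr_ge0 ?(ltW G1)// mulr_ge0 ?(ltW C0)//.
  by rewrite mulr_ge0 ?sqr_ge0.
rewrite decomp; exact: (energy_balance be_s cross quad meanW pos).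
Qed.

End domain.

End dissipativity.

(** * Densities, truncation and the range of the parameter *)

Local Open Scope charge_scope.
Local Open Scope ring_scope.

Section density.
Context (R : realType) d (T : measurableType d) (mu nu : probability T R).
Hypothesis numu : nu `<< mu.

Local Notation rho := ('d (charge_of_finite_measure nu) '/d mu).

(** The Cauchy-Schwarz inequality for the density of nu. *)
Lemma density_bound (g : T -> R) : bmeas g -> (forall x, 0 <= g x) ->
  (\int[nu]_x (g x)%:E <= 'N[mu]_2%:E[rho] * (Num.sqrt (\int[mu]_x (g x ^+ 2)))%:E)%E.
Proof.
move=> bg g0.
have ig : nu.-integrable setT (EFin \o g) by apply: bmeas_integrable => //; exact: probability_setT.
rewrite -(Radon_Nikodym_change_of_variables numu measurableT ig).
have numu' : charge_of_finite_measure nu `<< mu by exact: numu.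
pose f x := fine (rho x).
have fE x : rho x = (f x)%:E by rewrite /f fineK// Radon_Nikodym_fin_num.
have ir := Radon_Nikodym_integrable numu'.
have mf : measurable_fun setT f.
  apply/measurable_EFinP; rewrite (_ : EFin \o f = rho); last by apply/funext => x /=; rewrite fE.
  exact: (measurable_int mu).
have -> : ('N[mu]_2%:E[rho] = 'N[mu]_2%:E[(EFin \o f)])%E by apply: eq_Lnorm => x; rewrite fE.
rewrite -(Lnorm2_bmeas mu bg).
have -> : (\int[mu]_x ((EFin \o g) x * rho x) = \int[mu]_x (f x * g x)%:E)%E.
  by apply: eq_integral => x _; rewrite fE /= -EFinM mulrC.
have mfg : measurable_fun setT (fun x => (f x * g x)%:E).
  by apply/measurable_EFinP; apply: measurable_funM => //; exact: bg.1.
apply: (@le_trans _ _ ('N[mu]_1[EFin \o (f \* g)%R])%E).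
  rewrite Lnorm1; apply: (le_trans (lee_abs _)); exact: le_abse_integral.
by apply: hoelder => //; [exact: bg.1|field].
Qed.

Lemma density_norm_ge1 : (1 <= 'N[mu]_2%:E[rho])%E.
Proof.
have := @density_bound (fun=> 1) (bmeas_cst _ 1) (fun=> ler01).
rewrite integral_cst// [X in (_ * X)%E]probability_setT mule1.
under eq_Rintegral do rewrite expr1n.
by rewrite (bRintegral_cst (probability_setT mu)) sqrtr1 mule1.
Qed.

End density.

(** The function P_x(A) is at most 1, so that its square is at most itself. *)
Lemma law_bound (R : realType) (dE dO : measure_display)
    (E : measurableType dE) (Omega : measurableType dO) (P : R.-pker E ~> Omega)
    (mu nu : probability E R) (A : set Omega) : nu `<< mu -> measurable A ->
  (path_law P nu A <= 'N[mu]_2%:E['d (charge_of_finite_measure nu) '/d mu] *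
     (Num.sqrt (fine (path_law P mu A)))%:E)%E.
Proof.
move=> numu mA; pose g x := fine (P x A).
have PA x : P x A = (g x)%:E.
  rewrite /g fineK// ge0_fin_numE// (@le_lt_trans _ _ 1%E) ?ltry//.
  by rewrite -(kernel1 P x) le_measure// inE.
have g01 x : 0 <= g x <= 1.
  apply/andP; split; first by rewrite -lee_fin -PA.
  by rewrite -lee_fin -PA -(kernel1 P x) le_measure// inE.
have bg : bmeas g.
  apply: bmeas_itv g01; apply: measurableT_comp => //; exact: measurable_kernel.
have lawE (m : probability E R) : path_law P m A = (\int[m]_x (g x)%:E)%E.
  by rewrite path_lawE /law_from; apply: eq_integral => x _; rewrite PA.
rewrite lawE; apply: (le_trans (density_bound numu bg _)).
  by move=> x; have /andP[] := g01 x.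
apply: lee_wpmul2l; first exact: Lnorm_ge0.
rewrite lee_fin ler_wsqrtr//.
rewrite lawE -(EFin_Rintegral (probability_setT mu))//=.
apply: (bRintegral_le (probability_setT mu)) => //; [bm|] => x.
by have /andP[g0 g1] := g01 x; rewrite expr2 ler_piMr.
Qed.

Section truncation.
Context (R : realType) d (T : measurableType d) (mu : probability T R).
Variables (V : T -> R) (m : R).
Hypothesis mV : measurable_fun setT V.
Hypothesis V_mean : (\int[mu]_x (V x)%:E = 0)%E.
Hypothesis V_var : (\int[mu]_x (V x ^+ 2)%:E = (m ^+ 2)%:E)%E.

Definition truncated (B : R) (x : T) : R := Num.max (- B) (Num.min B (V x)).

Lemma truncated_itv B x : 0 <= B -> - B <= truncated B x <= B.
Proof.
move=> B0; rewrite /truncated le_max lexx/= ge_max ge_min lexx andbT.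
by rewrite (le_trans _ B0)// oppr_le0.
Qed.

Lemma measurable_truncated B : measurable_fun setT (truncated B).
Proof.
by apply: measurable_maxr; [exact: measurable_cst|apply: measurable_minr => //; exact: measurable_cst].
Qed.

Lemma bmeas_truncated B : 0 <= B -> bmeas (truncated B).
Proof. by move=> B0; apply: (bmeas_itv (measurable_truncated B)) => x; exact: truncated_itv. Qed.

Lemma truncatedE B x : 0 <= B -> truncated B x = if `|V x| <= B then V x else if 0 <= V x then B else - B.
Proof.
move=> B0; rewrite /truncated ler_norml; case: ifPn => [/andP[h1 h2]|].
  by rewrite (min_r h2) (max_r h1).
rewrite negb_and -!ltNge => /orP[VB|BV].
  have V0 : V x < 0 by rewrite (lt_le_trans VB)// oppr_le0.
  rewrite leNgt V0/= min_r; last by rewrite ltW// (lt_le_trans V0).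
  by rewrite max_l// ltW.
rewrite (le_trans B0 (ltW BV)) (min_l (ltW BV)) max_r//.
by rewrite (le_trans _ B0)// oppr_le0.
Qed.

Lemma truncated_le B x : 0 <= B -> `|truncated B x| <= `|V x|.
Proof.
move=> B0; rewrite truncatedE//; case: ifPn => //; rewrite -ltNge => BV.
by case: ifPn => _; rewrite ?normrN (ger0_norm B0) ltW.
Qed.

(** Where V is truncated, |V| exceeds B, hence |V| <= V^2 / B. *)
Lemma truncated_dist B x : 0 < B -> `|V x - truncated B x| <= V x ^+ 2 / B.
Proof.
move=> B0; rewrite (truncatedE _ (ltW B0)); case: ifPn => [_|].
  by rewrite subrr normr0 divr_ge0 ?sqr_ge0// ltW.
rewrite -ltNge => BV; rewrite ler_pdivlMr// -[V x ^+ 2]real_normK ?num_real// expr2.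
apply: ler_pM; [exact: normr_ge0|exact: ltW| |exact: ltW].
case: ifPn => [V0|].
  by move: BV; rewrite (ger0_norm V0) => BV; rewrite ger0_norm; lra.
rewrite -ltNge => V0; move: BV; rewrite (ltr0_norm V0) => BV.
rewrite ler0_norm; lra.
Qed.

Lemma truncated_L1 B : 0 < B -> (\int[mu]_x (`|V x - truncated B x|)%:E <= (m ^+ 2 / B)%:E)%E.
Proof.
move=> B0; rewrite mulrC EFinM -V_var -ge0_integralZl//; last 3 first.
- by apply/measurable_EFinP; exact: measurable_funX.
- by move=> x _; rewrite lee_fin sqr_ge0.
- by rewrite lee_fin invr_ge0 ltW.
have mT := measurable_truncated B.
apply: ge0_le_integral => //.
- apply/measurable_EFinP; apply: measurableT_comp => //; exact: measurable_funB.
- apply: measurable_funeM; apply/measurable_EFinP; exact: measurable_funX.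
- by move=> x _; rewrite -EFinM lee_fin mulrC truncated_dist.
Qed.

Lemma truncated_mean B : 0 < B -> `|\int[mu]_x truncated B x| <= m ^+ 2 / B.
Proof.
move=> B0; have mu1 := probability_setT mu.
have bT := bmeas_truncated (ltW B0).
have iT : mu.-integrable setT (EFin \o truncated B) by exact: bmeas_integrable.
have iD : mu.-integrable setT (EFin \o (fun x => V x - truncated B x)).
  apply/integrableP; split.
    by apply/measurable_EFinP; apply: measurable_funB => //; exact: measurable_truncated.
  by apply: le_lt_trans (truncated_L1 B0) _; rewrite ltry.
have : (\int[mu]_x (truncated B x)%:E + \int[mu]_x (V x - truncated B x)%:E = 0)%E.
  rewrite -integralD_EFin// -[RHS]V_mean.
  by apply: eq_integral => x _; rewrite /= -EFinD addrC subrK.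
rewrite -(EFin_Rintegral mu1 bT) => H.
have -> : \int[mu]_x truncated B x = - \int[mu]_x (V x - truncated B x).
  apply/eqP; rewrite -addr_eq0 -eqe EFinD /Rintegral [X in (_ + X)%E]fineK; last exact: integrable_fin_num.
  by rewrite H.
rewrite normrN -lee_fin; apply: le_trans (truncated_L1 B0).
rewrite EFin_normr_Rintegral//; apply: le_abse_integral => //.
exact: (measurable_int mu).
Qed.

End truncation.

(** A positive l excludes the degenerate cases G(1) = 0 and infinite norm, in
    which the upper end of the range is 0; norm 0 makes the range unbounded. *)
Lemma gauge_norm_admissible (R : realType) d (T : measurableType d)
    (mu : probability T R) (F : R -> R) (V : T -> R) (C l : R) :
  normalised_young (young_of F) -> 0 < C -> 0 < l ->
  (l%:E <= (young_of F 1)%:E /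
    ((2 * C)%:E * gauge_norm mu (fenchel_legendre (young_of F)) V))%E ->
  0 < young_of F 1 /\ (forall eta : R, 0 < eta -> exists2 v,
    gauge_admissible mu F V v & 2 * C * l * v <= young_of F 1 + eta).
Proof.
move=> HG C0 l0; set G := young_of F; set N := gauge_norm _ _ _.
have G10 : 0 <= G 1 by apply: young_ge0.
have N0 : (0 <= N)%E.
  by apply: le_ereal_inf_tmp => _ [v [v0 _] <-]; rewrite lee_fin ltW.
have C2 : 0 < 2 * C by rewrite mulr_gt0.
have adm (r e : R) : N = r%:E -> 0 < e -> exists2 v, gauge_admissible mu F V v & v < r + e.
  move=> Nr e0; have : (N < (r + e)%:E)%E by rewrite Nr lte_fin ltrDl.
  by move=> /ereal_inf_lt[_ [v Hv <-]]; rewrite lte_fin => vr; exists v.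
case Nr : N N0 => [r| |]// r0; last first.
  by rewrite gt0_muley ?lte_fin// invey mule0 lee_fin leNgt l0.
rewrite lee_fin in r0; rewrite -EFinM inver => H.
have [G1 rG] : 0 < G 1 /\ 2 * C * l * r <= G 1.
  move: H; have [->|rn] := eqVneq r 0.
    rewrite mulr0 eqxx mulr0; have [->|Gn] := eqVneq (G 1) 0.
      by rewrite mul0e lee_fin leNgt l0.
    by rewrite lt_neqAle eq_sym Gn G10.
  have rp : 0 < r by rewrite lt_neqAle eq_sym rn.
  rewrite ifF; last by rewrite gt_eqF// mulr_gt0.
  have Cr : 0 < 2 * C * r by exact: mulr_gt0.
  rewrite -EFinM lee_fin ler_pdivlMr// => H; split.
    by apply: lt_le_trans H; exact: mulr_gt0.
  by rewrite (le_trans _ H)// le_eqVlt; apply/predU1P; left; ring.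
split => // eta e0.
have d0 : 0 < eta / (2 * C * l) by rewrite divr_gt0// mulr_gt0.
have [v Av vr] := adm _ _ Nr d0; exists v => //.
have Cl : 0 < 2 * C * l by rewrite mulr_gt0.
have := ltW vr; rewrite -(ler_pM2l Cl) => /le_trans; apply.
by rewrite mulrDr lerD// mulrC divfK// gt_eqF.
Qed.

(** Taking logarithms turns the family of bounds into an upper bound on the
    supremum of the exponents. *)
Lemma sup_exponent_bound (R : realType) (x N t : R) (f : R -> R) (S : set R) :
  0 <= x -> 0 < N -> 0 < t ->
  (forall a, S a -> x <= N * expR (- (t * f a))) ->
  (x%:E <= N%:E * expeR (- (t%:E * ereal_sup [set (f a)%:E | a in S])))%E.
Proof.
move=> x0 N0 t0 H; have NE0 : (0 <= N%:E)%E by rewrite lee_fin ltW.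
have [->|xn] := eqVneq x 0; first by rewrite mule_ge0// expeR_ge0.
have xp : 0 < x by rewrite lt_neqAle eq_sym xn.
pose y := x / N; have y0 : 0 < y by rewrite divr_gt0.
have -> : x = N * y by rewrite /y mulrC divfK// gt_eqF.
rewrite EFinM; apply: lee_wpmul2l => //.
rewrite (_ : y%:E = expeR (ln y)%:E); last by rewrite /= lnK.
rewrite lee_expeR leeNr -EFinN.
apply: (@le_trans _ _ (t%:E * (- ln y / t)%:E)%E).
  apply: lee_wpmul2l; first by rewrite lee_fin ltW.
  apply: ge_ereal_sup => b [a Sa <-{b}]; rewrite lee_fin ler_pdivlMr//.
  have := H a Sa; rewrite mulrC -ler_pdivrMr// -/y.
  rewrite -ler_ln ?posrE// ?expR_gt0// expRK; lra.
by rewrite -EFinM mulrC divfK// gt_eqF.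
Qed.

(** * The deviation bound for one parameter *)

(** The errors a / k and b / k come from truncating at level k^3 and from giving
    up 1 / k of the deviation. *)
Lemma le_of_harmonic_error (R : realType) (x e a b : R) : 0 <= e -> 0 <= a -> 0 <= b ->
  (forall k, (0 < k)%N -> x <= e * expR (a / k%:R) + b / k%:R) -> x <= e.
Proof.
move=> e0 a0 b0 H; apply/ler_addgt0Pr => d d0.
pose D := 2 * a * e + b; have D0 : 0 <= D by rewrite addr_ge0// !mulr_ge0.
pose k := (Num.truncn (2 * a + D / d)).+1.
have kb : 2 * a + D / d < k%:R by exact: truncnS_gt.
have k0 : 0 < k%:R :> R by rewrite ltr0n.
have Dd : 0 <= D / d by rewrite divr_ge0// ltW.
have ak : a / k%:R <= 1 / 2.
  by rewrite ler_pdivrMr//; lra.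
have ak0 : 0 <= a / k%:R by rewrite divr_ge0// ltW.
have Dk : D / k%:R <= d.
  rewrite ler_pdivrMr// mulrC -ler_pdivrMr//; lra.
have expak : expR (a / k%:R) <= 1 + 2 * (a / k%:R).
  have := expR_taylor1 ak; rewrite ler_norml => /andP[_]; nra.
apply: (le_trans (H k _)) => //.
have := ler_wpM2l e0 expak.
have -> : e * (1 + 2 * (a / k%:R)) = e + D / k%:R - b / k%:R by rewrite /D; ring.
lra.
Qed.

Section occupation_time_tail.
Context (R : realType) (dE dO : measure_display).
Context (E : measurableType dE) (Omega : measurableType dO).
Variables (X : R -> Omega -> E) (P : R.-pker E ~> Omega).
Hypothesis HX : markov_process X P.
Variable mu : probability E R.
Hypothesis mu_inv : invariant_measure X P mu.
Hypothesis P_cont : L2_strongly_continuous X P mu.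
Variables (F : R -> R) (C : R).
Hypothesis HF : contractive_function F.
Hypothesis C0 : 0 < C.
Hypothesis HSF : strong_F_sobolev X P mu F C.
Variables (V : E -> R) (m : R).
Hypothesis mV : measurable_fun setT V.
Hypothesis V_mean : (\int[mu]_x (V x)%:E = 0)%E.
Hypothesis V_var : (\int[mu]_x (V x ^+ 2)%:E = (m ^+ 2)%:E)%E.
Variable nu : probability E R.
Hypothesis numu : nu `<< mu.

Let mu1 : mu setT = 1%E := probability_setT mu.
Local Notation Pmu := (path_law P mu).
Local Notation Pnu := (path_law P nu).
Local Notation G := (young_of F).
Local Notation norm := 'N[mu]_2%:E['d (charge_of_finite_measure nu) '/d mu]%E.

Variables t r : R.
Hypothesis t0 : 0 < t.

Definition mean_exceeds : set Omega := [set w | (r%:E <=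
  t^-1%:E * \int[lebesgue_measure]_(s in `[0%R, t]) (V (X s w))%:E)%E].

Let Vt (s : R) (w : Omega) : R := V (X (Num.max 0 s) w).

Let mVt : measurable_fun setT (fun p : measurableTypeR R * Omega => Vt p.1 p.2).
Proof. exact: (measurableT_comp mV (measurable_path_clip HX)). Qed.

Lemma clipped_time_integral w :
  (\int[lebesgue_measure]_(s in `[0%R, t]) (V (X s w))%:E =
   \int[lebesgue_measure]_(s in `[0%R, t]) (Vt s w)%:E)%E.
Proof.
apply: eq_integral => s; rewrite inE/= in_itv/= => /andP[s0 _].
by rewrite /Vt max_r.
Qed.

Lemma measurable_mean_exceeds : measurable mean_exceeds.
Proof.
pose I w := (t^-1%:E * \int[lebesgue_measure]_(s in `[0%R, t]) (Vt s w)%:E)%E.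
have mI : measurable_fun setT I.
  apply: measurable_funeM.
  have intE w : (\int[lebesgue_measure]_(s in `[0%R, t]) (Vt s w)%:E =
      \int[lebesgue_measure]_(s in `[0%R, t]) maxe (Vt s w)%:E 0 -
      \int[lebesgue_measure]_(s in `[0%R, t]) maxe (- (Vt s w)%:E) 0)%E.
    by rewrite integralE; congr (_ - _)%E; apply: eq_integral => s _; rewrite unlock.
  under eq_fun do rewrite intE.
  have mE : measurable_fun setT (fun p : measurableTypeR R * Omega => (Vt p.1 p.2)%:E).
    exact/measurable_EFinP.
  apply: emeasurable_funB.
  - apply: (measurable_time_integral (f := fun s w => maxe (Vt s w)%:E 0%E)) => //.
      by move=> s w; rewrite le_max lexx orbT.
    exact: measurable_maxe.
  - apply: (measurable_time_integral (f := fun s w => maxe (- (Vt s w)%:E)%E 0%E)) => //.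
      by move=> s w; rewrite le_max lexx orbT.
    by apply: measurable_maxe => //; exact: measurableT_comp.
rewrite (_ : mean_exceeds = I @^-1` `[r%:E, +oo[%classic).
  rewrite -[X in measurable X]setTI; apply: mI => //; exact: emeasurable_itv.
by apply/seteqP; split => w; rewrite /mean_exceeds /I /= in_itv/= andbT clipped_time_integral.
Qed.

Section parameters.
Variables l B e : R.
Hypotheses (l0 : 0 < l) (B0 : 0 < B) (e0 : 0 < e).
Hypothesis G1 : 0 < G 1.
Hypothesis adm : forall eta : R, 0 < eta ->
  exists2 v, gauge_admissible mu F V v & 2 * C * l * v <= G 1 + eta.

Local Notation W := (truncated V B).
(** The shift by B makes the potential nonnegative; it multiplies the exponential
    functional by exp(l B t), which is compensated in the threshold k0. *)
Let U (x : E) : R := l * (W x + B).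
Let c := 2 * m ^+ 2 * C / G 1.

Let bW : bmeas W := bmeas_truncated mV (ltW B0).
Let bU : bmeas U. Proof. by rewrite /U; bm. Qed.
Let U0M (x : E) : 0 <= U x <= 2 * l * B + 1.
Proof.
have /andP[h1 h2] := truncated_itv V x (ltW B0).
have : 0 <= W x + B <= 2 * B by apply/andP; split; lra.
move=> /andP[p1 p2]; rewrite /U mulr_ge0 ?(ltW l0)//=.
have := ler_wpM2l (ltW l0) p2; lra.
Qed.
Let M1 : 1 <= 2 * l * B + 1. Proof. by rewrite lerDr !mulr_ge0// ltW. Qed.

Let L := l * (m ^+ 2 / B) + c * l ^+ 2 + l * B.
Let L0 : 0 <= L.
Proof.
apply: addr_ge0; last by rewrite mulr_ge0// ltW.
apply: addr_ge0; first by rewrite mulr_ge0 ?(ltW l0)// divr_ge0 ?sqr_ge0// ltW.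
rewrite mulr_ge0 ?sqr_ge0// divr_ge0 ?(ltW G1)// mulr_ge0 ?(ltW C0)//.
by rewrite mulr_ge0 ?sqr_ge0.
Qed.

Lemma tilted_dissipative g Lg : bmeas g -> bmeas Lg -> L2_generator X P mu g Lg ->
  \int[mu]_x (U x * g x ^+ 2 + Lg x * g x) <= L * \int[mu]_x (g x ^+ 2).
Proof.
move=> bg bL Hg.
have := energy_form_le HX mu_inv HF C0 HSF G1 mV V_var bW
  (fun x => truncated_le V x (ltW B0)) bg bL Hg (ltW l0) (truncated_mean mV V_mean V_var B0) adm.
rewrite opprK => H.
rewrite (bRintegralD mu1); [|bm|bm].
have -> : \int[mu]_x (U x * g x ^+ 2) =
    l * \int[mu]_x (W x * g x ^+ 2) + l * B * \int[mu]_x (g x ^+ 2).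
  rewrite -(bRintegralZl mu1 l); last bm.
  rewrite -(bRintegralZl mu1 (l * B)); last bm.
  rewrite -(bRintegralD mu1); [|bm|bm].
  by apply: eq_Rintegral => x _; rewrite /U; ring.
rewrite /L mulrDl addrAC lerD2r; exact: H.
Qed.

Local Notation Z := (afun X U 0 t).

Lemma fk_L2_bound : Num.sqrt (\int[mu]_x (fk X P U t x ^+ 2)) <= expR (L * t).
Proof.
have := fk_growth HX mu_inv P_cont bU.1 M1 U0M L0 tilted_dissipative (ltW t0).
have -> : expR (2 * L * t) = expR (L * t) ^+ 2 by rewrite -expRM_natr; congr expR; ring.
move=> /ler_wsqrtr/le_trans; apply.
by rewrite sqrtr_sqr ger0_norm ?expR_ge0.
Qed.

Let k0 := l * ((r - e) * t) + l * B * t.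
Let A1 : set Omega := [set w | k0 <= Z w].
Let bZ : bmeas Z := bmeas_afun HX bU.1 U0M (ltW t0).

Let mA1 : measurable A1.
Proof.
rewrite (_ : A1 = Z @^-1` `[k0, +oo[%classic).
  by rewrite -[X in measurable X]setTI; apply: bZ.1 => //; exact: measurable_itv.
by apply/seteqP; split => w; rewrite /= in_itv/= andbT.
Qed.

(** Exponential Chebyshev inequality under each P_x, then the density of nu and
    the growth bound of the Feynman-Kac function. *)
Lemma exponential_tail : (Pnu A1 <= norm * (expR (L * t - k0))%:E)%E.
Proof.
have bF := bmeas_fk HX bU.1 U0M (ltW t0) (P := P).
have PA1 x : (P x A1 <= (expR (- k0) * fk X P U t x)%:E)%E.
  have bexp : bmeas (fun w => expR (- k0) * expR (Z w)) by bm.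
  rewrite /fk -(bRintegralZl (kernel1 P x)); last bm.
  rewrite (EFin_Rintegral (kernel1 P x))// -[leLHS]mul1e -[leLHS]integral_cst//.
  rewrite integral_mkcond; apply: ge0_le_integral => //.
  - by move=> w _; rewrite epatch_indic /= mul1e lee_fin.
  - by rewrite epatch_indic; apply: emeasurable_funM => //; exact/measurable_EFinP.
  - by apply/measurable_EFinP/bmeas_meas.
  - move=> w _; rewrite epatch_indic /= mul1e lee_fin -expRD indicE.
    have [/set_mem wA|_] := boolP (w \in A1); last exact: expR_ge0.
    by rewrite -expR0 ler_expR addrC subr_ge0.
pose g x := expR (- k0) * fk X P U t x.
have bg : bmeas g by rewrite /g; bm.
have g0 x : 0 <= g x by rewrite mulr_ge0 ?expR_ge0// Rintegral_ge0// => w _; exact: expR_ge0.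
rewrite path_lawE /law_from.
apply: (@le_trans _ _ (\int[nu]_x (g x)%:E)%E).
  apply: ge0_le_integral => //.
  - exact: measurable_kernel.
  - by apply/measurable_EFinP/bmeas_meas.
apply: (le_trans (density_bound numu bg g0)); apply: lee_wpmul2l; first exact: Lnorm_ge0.
rewrite lee_fin.
have -> : \int[mu]_x (g x ^+ 2) = expR (- k0) ^+ 2 * \int[mu]_x (fk X P U t x ^+ 2).
  rewrite -(bRintegralZl mu1); last bm.
  by apply: eq_Rintegral => x _; rewrite exprMn.
rewrite sqrtrM ?sqr_ge0// sqrtr_sqr ger0_norm ?expR_ge0// addrC expRD ler_pM2l ?expR_gt0//.
exact: fk_L2_bound.
Qed.

Let J w := (\int[lebesgue_measure]_(s in `[0%R, t])
  (`|Vt s w - W (X (Num.max 0 s) w)|)%:E)%E.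
Let A2 : set Omega := [set w | ((e * t)%:E <= J w)%E].

Let mVW : measurable_fun setT (fun x => (`|V x - W x|)%:E).
Proof.
by apply/measurable_EFinP; apply: measurableT_comp => //; apply: measurable_funB => //; exact: bW.1.
Qed.

Let mD : measurable_fun setT (fun p : measurableTypeR R * Omega =>
  (`|Vt p.1 p.2 - W (X (Num.max 0 p.1) p.2)|)%:E).
Proof. exact: (measurableT_comp mVW (measurable_path_clip HX)). Qed.

Let mJ : measurable_fun setT J.
Proof.
apply: (measurable_time_integral (f := fun s w => (`|Vt s w - W (X (Num.max 0 s) w)|)%:E)) => //.
Qed.

Let mA2 : measurable A2.
Proof.
rewrite (_ : A2 = J @^-1` `[(e * t)%:E, +oo[%classic).
  by rewrite -[X in measurable X]setTI; apply: mJ => //; exact: emeasurable_itv.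
by apply/seteqP; split => w; rewrite /= in_itv/= andbT.
Qed.

(** Markov's inequality; by stationarity the expected time integral is t times
    the distance of V to its truncation in L1(mu). *)
Lemma truncation_error_tail : (Pmu A2 <= (m ^+ 2 / B / e)%:E)%E.
Proof.
have et0 : 0 < e * t by rewrite mulr_gt0.
have J0 w : (0 <= J w)%E by apply: integral_ge0 => s _; rewrite lee_fin.
have : ((e * t)%:E * Pmu A2 <= \int[Pmu]_w J w)%E.
  rewrite -[leLHS]integral_cst// integral_mkcond; apply: ge0_le_integral => //.
  - by move=> w _; rewrite epatch_indic /= -EFinM lee_fin mulr_ge0// ltW.
  - by rewrite epatch_indic; apply: emeasurable_funM => //; exact/measurable_EFinP.
  - move=> w _; rewrite epatch_indic /= indicE.
    by have [/set_mem wA|_] := boolP (w \in A2); rewrite ?mule1 ?mule0.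
rewrite (tonelli_time (path_law P mu)
  (f := fun s w => (`|Vt s w - W (X (Num.max 0 s) w)|)%:E))//.
have -> : (\int[lebesgue_measure]_(s in `[0%R, t]) \int[Pmu]_w (`|Vt s w - W (X (Num.max 0 s) w)|)%:E =
    \int[lebesgue_measure]_(s in `[0%R, t]) \int[mu]_x (`|V x - W x|)%:E)%E.
  apply: eq_integral => s _.
  have s0 : 0 <= Num.max 0 s by rewrite le_max lexx.
  by rewrite -(stationary_ge0 HX mu_inv s0 (f := fun x => (`|V x - W x|)%:E)).
rewrite integral_cst//= [X in (_ <= _ * X)%E](lebesgue_measure_itv `[0%R, t])/= lte_fin t0 oppr0 adde0.
move=> /le_trans /(_ (lee_wpmul2r _ (truncated_L1 mV V_var B0))) => H.
have {}H := H (ltW t0).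
rewrite -(fineK (x := Pmu A2)); last by rewrite fin_num_measure.
rewrite lee_fin ler_pdivlMr// -(ler_pM2r t0).
move: H; rewrite -[X in (_ * X <= _)%E](fineK (x := Pmu A2)) ?fin_num_measure//.
by rewrite -!EFinM lee_fin (mulrC (e * t)) mulrA.
Qed.

(** The inclusion holds for every path.  If V - W is not integrable in time along
    the path then J is infinite and the path lies in A2, so that paths on which
    the time integral of V is not defined raise no difficulty. *)
Lemma mean_exceeds_sub : mean_exceeds `<=` A1 `|` A2.
Proof.
move=> w; rewrite /mean_exceeds /= clipped_time_integral => Hw.
have [HJ|HJ] := leP (e * t)%:E (J w); [by right|left].
have bWt := bmeas_time HX w bW.
have iW := bmeas_itv_integrable 0 t bWt.
have mVw : measurable_fun setT (fun s : measurableTypeR R => Vt s w).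
  exact: (measurableT_comp mVt (@pair2_measurable _ _ (measurableTypeR R) Omega w)).
have iD : lebesgue_measure.-integrable `[0%R, t]
    (EFin \o (fun s : measurableTypeR R => Vt s w - W (X (Num.max 0 s) w))).
  apply/integrableP; split.
    by apply/measurable_EFinP; apply: measurable_funTS; apply: measurable_funB => //; exact: bWt.1.
  by apply: lt_trans HJ _; rewrite ltry.
have VE : (\int[lebesgue_measure]_(s in `[0%R, t]) (Vt s w)%:E =
    \int[lebesgue_measure]_(s in `[0%R, t]) (W (X (Num.max 0 s) w))%:E +
    \int[lebesgue_measure]_(s in `[0%R, t]) (Vt s w - W (X (Num.max 0 s) w))%:E)%E.
  rewrite -integralD_EFin//.
  by apply: eq_integral => s _; rewrite /= -EFinD addrC subrK.
have WE : (\int[lebesgue_measure]_(s in `[0%R, t]) (W (X (Num.max 0 s) w))%:E =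
    (afun X W 0 t w)%:E)%E.
  by rewrite /afun /Rintegral fineK//; exact: integrable_fin_num.
have DJ : (\int[lebesgue_measure]_(s in `[0%R, t]) (Vt s w - W (X (Num.max 0 s) w))%:E < (e * t)%:E)%E.
  apply: le_lt_trans HJ; apply: (le_trans (lee_abs _)).
  by apply: le_abse_integral => //; exact: (measurable_int _ iD).
have ZE : Z w = l * afun X W 0 t w + l * B * t.
  rewrite /afun /U -RintegralZl//.
  rewrite -[X in l * B * X]subr0 -(Rintegral_itv_cst (l * B) (ltW t0)) -RintegralD//; last 2 first.
  - by apply: (bmeas_itv_integrable (f := fun s => l * W (X (Num.max 0 s) w))); bm.
  - by apply: (bmeas_itv_integrable (f := fun s => l * B)); bm.
  by apply: eq_Rintegral => s _; rewrite mulrDr.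
rewrite /A1 /= ZE /k0 lerD2r ler_pM2l//.
have : ((r * t)%:E < (afun X W 0 t w)%:E + (e * t)%:E)%E.
  apply: (@le_lt_trans _ _ (\int[lebesgue_measure]_(s in `[0%R, t]) (Vt s w)%:E)%E); last first.
    by rewrite VE WE lteD2lE.
  have := @lee_wpmul2l R t%:E; rewrite lee_fin => /(_ (ltW t0) _ _ Hw).
  by rewrite muleA -!EFinM mulfV ?gt_eqF// mul1e mulrC.
by rewrite -EFinD lte_fin => /ltW; lra.
Qed.

Lemma mean_exceeds_truncated_bound : (Pnu mean_exceeds <=
  norm * (expR (t * (c * l ^+ 2 - r * l) + t * l * (m ^+ 2 / B + e)) +
          Num.sqrt (m ^+ 2 / B / e))%:E)%E.
Proof.
apply: (@le_trans _ _ (Pnu A1 + Pnu A2)%E).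
  apply: le_trans (measureU2 _ mA1 mA2); apply: le_measure mean_exceeds_sub; rewrite inE.
    exact: measurable_mean_exceeds.
  exact: measurableU.
rewrite [X in (_ <= _ * X)%E]EFinD ge0_muleDr ?lee_fin ?expR_ge0 ?sqrtr_ge0//; apply: leeD.
  apply: (le_trans exponential_tail); apply: lee_wpmul2l; first exact: Lnorm_ge0.
  by rewrite lee_fin ler_expR le_eqVlt; apply/predU1P; left; rewrite /L /k0; ring.
apply: (le_trans (law_bound P numu mA2)); apply: lee_wpmul2l; first exact: Lnorm_ge0.
rewrite lee_fin ler_wsqrtr// -lee_fin fineK ?fin_num_measure//.
exact: truncation_error_tail.
Qed.

End parameters.
End occupation_time_tail.

(** * The deviation inequality *)

Unset Implicit Arguments.
Local Close Scope ring_scope.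
Local Open Scope charge_scope.
Local Open Scope ereal_scope.

Theorem theorem2p16 (R : realType) (E : ptopologicalType) (HE : polish_space R E)
  (dO : measure_display) (Omega : measurableType dO)
  (X : R -> Omega -> borelType E) (P : R.-pker (borelType E) ~> Omega)
  (HX : markov_process X P)
  (mu : probability (borelType E) R)
  (mu_inv : invariant_measure X P mu) (mu_erg : ergodic_measure X P mu)
  (P_cont : L2_strongly_continuous X P mu)
  (F : R -> R) (HF : contractive_function F)
  (C_SF : R) (C_SF_gt0 : (0 < C_SF)%R)
  (HSF : strong_F_sobolev X P mu F C_SF)
  (V : borelType E -> R) (mV : measurable_fun setT V) (m : R)
  (V_mean : \int[mu]_x (V x)%:E = 0)
  (V_var : \int[mu]_x (V x ^+ 2)%:E = (m ^+ 2)%:E) :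
  let G := young_of F in
  let lambda2 :=
    (G 1%R)%:E / ((2 * C_SF)%:E * gauge_norm mu (fenchel_legendre G) V) in
  forall (nu : probability (borelType E) R), nu `<< mu ->
  forall t r : R, (0 < t)%R -> (0 < r)%R ->
  let norm := 'N[mu]_2%:E['d (charge_of_finite_measure nu) '/d mu] in
  law_from P nu
    [set w | r%:E <=
       t^-1%:E * \int[lebesgue_measure]_(s in `[0%R, t]) (V (X s w))%:E] <=
  if norm == +oo then +oo else
    norm * expeR (- (t%:E * ereal_sup
      [set (r * l - 2 * m ^+ 2 * C_SF / G 1%R * l ^+ 2)%:E | l in
         [set l : R | (0 <= l)%R /\ l%:E <= lambda2]])).
Proof.
move=> G lambda2 nu numu t r t0 r0; cbv zeta.
set norm := 'N[mu]_2%:E['d (charge_of_finite_measure nu) '/d mu].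
case: ifPn => [_|norm_fin]; first exact: leey.
have HG : normalised_young G := proj2 HF.
have norm1 : 1 <= norm by exact: density_norm_ge1.
have normE : norm = (fine norm)%:E.
  by rewrite fineK// ge0_fin_numE ?ltey// (le_trans _ norm1).
have N0 : (0 < fine norm)%R by rewrite -lte_fin -normE (lt_le_trans _ norm1).
pose A := mean_exceeds X V t r.
have mA : measurable A := measurable_mean_exceeds HX mV t r.
have A1 : path_law P nu A <= 1 by exact: probability_le1.
have AE : law_from P nu A = (fine (path_law P nu A))%:E.
  by rewrite -path_lawE fineK ?fin_num_measure.
rewrite [leLHS]AE normE; apply: sup_exponent_bound => //; first exact: fine_ge0.
move=> l /= [l0 ll2].
rewrite -lee_fin -AE EFinM -normE -path_lawE.
move: l0; rewrite le_eqVlt => /predU1P[l0|l0].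
  rewrite -l0 !mulr0 expr0n/= mulr0 subr0 mulr0 oppr0 expR0 mule1.
  exact: le_trans norm1.
have [G1 adm] := gauge_norm_admissible HG C_SF_gt0 l0 ll2.
set c := (2 * m ^+ 2 * C_SF / G 1)%R.
have -> : (- (t * (r * l - c * l ^+ 2)) = t * (c * l ^+ 2 - r * l))%R.
  by rewrite -mulrN opprB.
rewrite -path_lawE in AE; rewrite [leLHS]AE normE -EFinM lee_fin.
apply: (@le_of_harmonic_error _ _ _ (t * l * (m ^+ 2 + 1)) (fine norm * `|m|)).
- by rewrite mulr_ge0 ?expR_ge0// ltW.
- by rewrite mulr_ge0 ?addr_ge0 ?sqr_ge0// mulr_ge0// ltW.
- by rewrite mulr_ge0// ltW.
(* truncation at level k^3 and loss 1 / k: the tail error is then |m| / k *)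
move=> k k0; have kp : (0 < k%:R :> R)%R by rewrite ltr0n.
have k1 : (1 <= k%:R :> R)%R by rewrite ler1n.
have B0 : (0 < k%:R ^+ 3 :> R)%R by rewrite exprn_gt0.
have e0 : (0 < k%:R^-1 :> R)%R by rewrite invr_gt0.
have := mean_exceeds_truncated_bound HX mu_inv P_cont HF C_SF_gt0 HSF mV V_mean V_var numu r t0 l0 B0 e0 G1 adm.
rewrite [X in X <= _]AE -/norm normE -EFinM lee_fin -/c => /le_trans; apply.
rewrite mulrDr; apply: lerD.
  rewrite -[leRHS]mulrA ler_pM2l// -expRD ler_expR lerD2l -[leRHS]mulrA ler_pM2l ?mulr_gt0//.
  rewrite mulrDl mul1r lerD2r ler_wpM2l ?sqr_ge0// lef_pV2 ?posrE//.
  by rewrite exprS ler_peMr ?exprn_ege1// ltW.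
rewrite -[leRHS]mulrA ler_pM2l// invrK.
have -> : (m ^+ 2 / k%:R ^+ 3 * k%:R = (m / k%:R) ^+ 2)%R by field; rewrite gt_eqF.
by rewrite sqrtr_sqr normrM [X in (_ * X)%R]ger0_norm// invr_ge0.
Qed.
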